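(* Let $u$ be a solution of the superconductivity problem $\Delta u=\chi_{\{|\nabla u|>0\}}$ in $B_1\subset\mathbb{R}^n$ (in the sense described in the context), and suppose $0\in\Sigma$ and $$u\le u(0)\quad\text{on }\{x\in B_1: |\nabla u(x)|=0\}.$$ Then there exists $q_0\in\mathcal{Q}$ such that $$u_r(x):=\frac{u(rx)-u(0)}{r^2}\longrightarrow q_0\quad\text{in } C^{1,\alpha}_{\rm loc}(\mathbb{R}^n)\ \text{ as } r\to0^+$$ for every $\alpha\in(0,1)$ (i.e. the full family converges, not merely along a subsequence). Moreover, $$u(x)-u(0)=q_0(x)+o(|x|^2)\quad\text{as } x\to0 .$$
   Context: $B_1$ is the open unit ball of $\mathbb{R}^n$. A solution of $\Delta u=\chi_{\{|\nabla u|>0\}}$ in $B_1$ means a function $u\in C^{1,1}_{\rm loc}(B_1)$ with $\|D^2u\|_{L^\infty(B_1)}\le M$ for some constant $M>0$, satisfying $\Delta u=\chi_{\{|\nabla u|>0\}}$ a.e. in $B_1$, and with $0\in\Gamma:=\partial\{|\nabla u|>0\}\cap B_1$ (the free boundary). $\mathcal{Q}$ denotes the set of homogeneous quadratic polynomials $q$ on $\mathbb{R}^n$ with $\Delta q=1$, i.e. $q(x)=\tfrac12 x\cdot Ax$ with $A$ symmetric and $\operatorname{Tr}A=1$. The singular set $\Sigma\subset\Gamma$ is defined by: $x^0\in\Sigma$ iff there exists a sequence $r_j\to0$ such that $u_{x^0,r_j}(x):=\frac{u(x^0+r_jx)-u(x^0)}{r_j^2}$ converges (in $C^{1,\alpha}_{\rm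 loc}(\mathbb{R}^n)$) to some $q\in\mathcal{Q}$. *)

(* Defs.v *)
From HB Require Import structures.
From mathcomp Require Import all_boot all_order all_algebra.
From mathcomp Require Import all_classical all_reals all_analysis.
Set Implicit Arguments. Unset Strict Implicit. Unset Printing Implicit Defensive.
Import Order.TTheory GRing.Theory Num.Theory.
Import numFieldNormedType.Exports.
Local Open Scope classical_set_scope.
Local Open Scope ring_scope.

Section Defs.
Variables (R : realType) (n : nat).
Notation V := 'rV[R]_n.

(* Euclidean norm |x| on R^n (the library's norm on rows is the sup norm) *)
Definition enorm (x : V) : R := Num.sqrt (\sum_(i < n) x 0 i ^+ 2).

Definition eball (c : V) (rho : R) : set V := [set x | enorm (x - c) < rho].
Definition ecball (rho : R) : set V := [set x | enorm x <= rho].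

Definition B1 : set V := eball 0 1.

Definition evec (i : 'I_n) : V := delta_mx 0 i.

Definition grad (f : V -> R) (x : V) : V := \row_(i < n) 'D_(evec i) f x.

Definition lap (f : V -> R) (x : V) : R :=
  \sum_(i < n) 'D_(evec i) (fun y => 'D_(evec i) f y) x.

(* Lebesgue-null subsets of R^n: coverable by countably many cubes
   (center c k, half side h k) of arbitrarily small total volume *)
Definition cube (c : V) (h : R) : set V := [set x | forall i, `|x 0 i - c 0 i| < h].
Definition null_set (A : set V) : Prop :=
  forall eps : R, 0 < eps -> exists (c : nat -> V) (h : nat -> R),
    (forall k, 0 < h k) /\
    A `<=` \bigcup_k cube (c k) (h k) /\
    (forall N, \sum_(k < N) (2 * h k) ^+ n <= eps).

(* u solves Delta u = chi_{|grad u| > 0} in B_1 (C^{1,1} in B_1 with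
   ||D^2 u||_oo <= M, i.e. grad u is M-Lipschitz in B_1, equation a.e.) *)
Definition supercond_solution (u : V -> R) : Prop :=
  (forall x, B1 x -> differentiable u x) /\
  (exists M : R, 0 < M /\
     forall x y, B1 x -> B1 y -> enorm (grad u x - grad u y) <= M * enorm (x - y)) /\
  null_set [set x | B1 x /\
     ~ ((forall i, derivable (fun y => 'D_(evec i) u y) x (evec i)) /\
        lap u x = (if grad u x != 0 then 1 else 0))].

Definition posgrad (u : V -> R) : set V := [set x | B1 x /\ grad u x != 0].
Definition free_boundary (u : V -> R) : set V :=
  [set x | B1 x /\ closure (posgrad u) x /\ ~ (interior (posgrad u)) x].

Definition quadp (A : 'M[R]_n) (x : V) : R := 2^-1 * (x *m A *m x^T) 0 0.
Definition inQ (q : V -> R) : Prop :=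
  exists A : 'M[R]_n, A^T = A /\ \tr A = 1 /\ q = quadp A.

Definition resc (u : V -> R) (x0 : V) (r : R) : V -> R :=
  fun x => (u (x0 + r *: x) - u x0) / r ^+ 2.

Definition C1a_close (alpha rho eps : R) (f g : V -> R) : Prop :=
  (forall x, ecball rho x -> differentiable f x) /\
  forall x y, ecball rho x -> ecball rho y ->
    `|f x - g x| <= eps /\
    enorm (grad f x - grad g x) <= eps /\
    enorm ((grad f x - grad g x) - (grad f y - grad g y))
      <= eps * (enorm (x - y)) `^ alpha.

Definition C1a_loc_cvg {I : Type} (F : set_system I) (alpha : R)
    (f : I -> V -> R) (g : V -> R) : Prop :=
  forall rho eps : R, 0 < rho -> 0 < eps ->
    \forall t \near F, C1a_close alpha rho eps (f t) g.

Definition singular_set (u : V -> R) : set V :=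
  [set x0 | free_boundary u x0 /\
     exists (r : nat -> R) (q : V -> R) (alpha : R),
       (forall j, 0 < r j) /\ r @ \oo --> (0 : R) /\
       inQ q /\ 0 < alpha < 1 /\
       C1a_loc_cvg \oo alpha (fun j => resc u x0 (r j)) q].

End Defs.

(* Main.v *)
(* Normalize u(0) = 0 and put u_r(x) = u(r x) / r^2, Zv = x.grad v - 2 v.  With a radial
   cutoff eta and the weight b determined by grad eta = - b x, consider the Weiss energy
     E(v) = int eta |grad v|^2 + 2 v eta - 2 v^2 b.
   Testing the equation with (u_{r(1+e)} - u_r) eta, which equals e Z(u_r) eta up to O(e^2)
   and is nonnegative on {grad u_r = 0} because u <= 0 there, gives
   E(u_{r(1+e)}) >= E(u_r) - C e^2, so E(u_r) is nondecreasing in r.  E is constant on Q, hence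
   E(u_r) >= E(q) for every q in Q as soon as one blow-up limit is in Q.
   For q in Q and w = u_r - q,
     int b w Zw = E(u_r) - E(q) + int_{grad u_r = 0} (q - u_r) eta
               >= int_{grad u_r = 0} q eta.
   For the isotropic q = |x|^2 / 2n the right-hand side is nonnegative, so that the Monneau
   functional M_q(r) = int b (u_r - q)^2 is nondecreasing.  For an arbitrary q in Q the right-hand
   side is at least - C times the isotropic one, so that M_q + C M_iso is nondecreasing.  Hence M_q
   has a limit as r -> 0, which is 0 if q is a subsequential blow-up limit.  The uniform C^{1,1}
   bound upgrades this L^2 convergence to C^{1,alpha}. *)
Require Import Defs.
From HB Require Import structures.
From mathcomp Require Import all_boot all_order all_algebra.
From mathcomp Require Import all_classical all_reals all_analysis.
From mathcomp Require Import ring lra zify.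
Set Implicit Arguments. Unset Strict Implicit. Unset Printing Implicit Defensive.
Import Order.TTheory GRing.Theory Num.Theory.
Import numFieldNormedType.Exports.
Local Open Scope classical_set_scope.
Local Open Scope ring_scope.

(** * Integration of bounded functions over the cube [[-2, 2]^n] *)

Section UltraLimit.
Variable R : realType.

(** The gradient of [u] is only Lipschitz and the equation holds only almost everywhere, so no
    computation may use second derivatives. The equation enters through one functional, [wlap]: the
    integral of xi (1 - Delta u), already integrated by parts. Two facts about it are used: it is
    nonnegative when xi >= 0 on {grad u = 0}, and it vanishes for q in Q. The integral [integ] is a
    finitely additive mean and has no convergence theorems of its own; what countable additivity
    would provide is recovered by Daniell's argument for sequences of continuous functions, here
    built from difference quotients of the gradient. Monotonicity in r is not obtained by
    differentiation either: the scales r and r (1 + e) are compared with an error C e^2, C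
    independent of r, and many small steps are added. The radii are nested: integrals live on the
    cube of half side 2, shifts of its points reach half side 3, and rescaled solutions are
    controlled on half side 6, which leaves room for a dilation by a factor up to 2. *)

Definition ultra : set_system nat :=
  projT1 (cid (ultraFilterLemma eventually_filter)).

Global Instance ultra_UltraFilter : UltraFilter ultra.
Proof. by rewrite /ultra; case: cid => G []. Qed.

Lemma eventually_sub_ultra : eventually `<=` ultra.
Proof. by rewrite /ultra; case: cid => G []. Qed.

(** Compactness of a segment gives a cluster point, and an ultrafilter converges to its cluster
    points: a neighbourhood outside it would have its complement inside. *)
Lemma ultra_cvg (a : nat -> R) :
  (exists C, \forall m \near \oo, `|a m| <= C) -> cvg (a @ ultra).
Proof.
move=> [C /eventually_sub_ultra aC].
have /(_ (a @ ultra)) := @segment_compact R (- C) C.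
have aF : (a @ ultra) `[- C, C]%classic.
  by apply: filterS aC => m; rewrite /= in_itv /= -ler_norml.
move=> /(_ _ aF) [p [_ clp]].
apply/cvg_ex; exists p => A pA.
have [//|FnA] := in_ultra_setVsetC (a @^-1` A) ultra_UltraFilter.
have FnA' : (a @ ultra) (~` A) by [].
by have [x []] := clp _ _ FnA' pA.
Qed.

End UltraLimit.

Section Riemann.
Variables (R : realType) (n : nat).
Notation V := 'rV[R]_n.
Implicit Types (f g : V -> R) (x y : V) (m : nat).

Lemma coord_le_norm x i : `|x 0 i| <= `|x|.
Proof.
rewrite [leRHS]/Num.norm /= mx_normrE.
by apply/bigmax_geP; right => /=; exists (0, i).
Qed.

Lemma norm_leP x c : 0 <= c -> (`|x| <= c) <-> (forall i, `|x 0 i| <= c).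
Proof.
move=> c0; split=> [h i|h]; first exact: le_trans (coord_le_norm _ _) h.
rewrite [leLHS]/Num.norm /= mx_normrE; apply/bigmax_leP; split => // -[i j] _ /=.
by rewrite ord1; exact: h.
Qed.

(** Left endpoints of the subdivision of [-2, 2] into 2^(m+2) dyadic intervals on each axis. Dyadic
    steps make a translation by 2^-j a whole number of steps of every grid with m >= j. *)
Definition gpt m (k : {ffun 'I_n -> 'I_(2 ^ (m + 2))}) : V :=
  \row_i (-2 + 2 ^- m * (k i)%:R).

Definition rsum m f : R := (2 ^- m) ^+ n * \sum_k f (@gpt m k).

(* The ultralimit gives a linear, positive functional on all bounded functions, with no
   measurability or convergence requirement. *)
Definition integ f : R := lim (rsum m f @[m --> ultra]).

Definition bdd f := exists C, forall x, `|x| <= 2 -> `|f x| <= C.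

Lemma step_gt0 m : 0 < 2 ^- m :> R.
Proof. by rewrite invr_gt0 exprn_gt0. Qed.

Lemma step_mulX m : 2 ^- m * (2 ^ (m + 2))%:R = 4 :> R.
Proof.
by rewrite natrX exprD mulrA mulVf ?mul1r -?natrX// natrX expf_neq0.
Qed.

Lemma gpt_coord m (k : {ffun 'I_n -> 'I_(2 ^ (m + 2))}) i :
  -2 <= gpt k 0 i /\ gpt k 0 i <= 2 - 2 ^- m.
Proof.
rewrite mxE; have h := step_gt0 m; split.
  by rewrite lerDl mulr_ge0 // ltW.
have := ltn_ord (k i); rewrite -(ler_nat R) -natr1 => hk.
have : 2 ^- m * ((k i)%:R + 1) <= 2 ^- m * (2 ^ (m + 2))%:R :> R.
  by rewrite ler_wpM2l // ltW.
by rewrite step_mulX; lra.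
Qed.

Lemma gpt_le m (k : {ffun 'I_n -> 'I_(2 ^ (m + 2))}) : `|gpt k| <= 2.
Proof.
apply/norm_leP => // i; have [] := gpt_coord k i; have := step_gt0 m.
by move=> h0 h1 h2; rewrite ler_norml; apply/andP; split => //; lra.
Qed.

Lemma rsumD m f g : rsum m (fun x => f x + g x) = rsum m f + rsum m g.
Proof. by rewrite /rsum big_split mulrDr. Qed.

Lemma rsumZ m c f : rsum m (fun x => c * f x) = c * rsum m f.
Proof. by rewrite /rsum -mulr_sumr mulrCA. Qed.

Lemma le_rsum m f g : (forall x, `|x| <= 2 -> f x <= g x) -> rsum m f <= rsum m g.
Proof.
move=> fg; rewrite /rsum ler_wpM2l ?exprn_ge0 ?invr_ge0 ?exprn_ge0 //.
by apply: ler_sum => k _; apply: fg; exact: gpt_le.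
Qed.

Lemma rsum_cst m c : rsum m (fun=> c) = c * 4 ^+ n.
Proof.
rewrite /rsum sumr_const cardT -cardE card_ffun !card_ord -[c *+ _]mulr_natr mulrCA.
by rewrite natrX -exprMn step_mulX.
Qed.

Lemma rsum_cvg f : bdd f -> cvg (rsum m f @[m --> ultra]).
Proof.
move=> [C fC]; apply: ultra_cvg; exists (C * 4 ^+ n); near=> m.
rewrite -(rsum_cst m) ler_norml; apply/andP; split.
  rewrite -[X in - X]mul1r -mulNr -rsumZ; apply: le_rsum => x /fC.
  by rewrite ler_norml mulN1r => /andP[].
by apply: le_rsum => x /fC; rewrite ler_norml => /andP[].
Unshelve. all: end_near. Qed.

Lemma integD f g : bdd f -> bdd g ->
  integ (fun x => f x + g x) = integ f + integ g.
Proof.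
move=> bf bg; rewrite /integ; under eq_fun do rewrite rsumD.
by rewrite limD //; exact: rsum_cvg.
Qed.

Lemma integZ c f : bdd f -> integ (fun x => c * f x) = c * integ f.
Proof.
move=> bf; rewrite /integ; under eq_fun do rewrite rsumZ.
by apply: cvg_lim => //; apply: cvgMr; exact: rsum_cvg.
Qed.

Lemma integ_cst c : integ (fun=> c) = c * 4 ^+ n.
Proof.
rewrite /integ; under eq_fun do rewrite rsum_cst.
by apply: cvg_lim => //; exact: cvg_cst.
Qed.

Lemma le_integ f g : bdd f -> bdd g ->
  (forall x, `|x| <= 2 -> f x <= g x) -> integ f <= integ g.
Proof.
move=> bf bg fg; apply: ler_lim; [exact: rsum_cvg|exact: rsum_cvg|].
by near=> m; exact: le_rsum.
Unshelve. all: end_near. Qed.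

Lemma eq_integ f g : (forall x, `|x| <= 2 -> f x = g x) -> integ f = integ g.
Proof.
move=> fg; rewrite /integ.
suff -> : rsum ^~ f = rsum ^~ g by [].
by apply/funext => m; rewrite /rsum; congr (_ * _); apply: eq_bigr => k _; apply: fg; exact: gpt_le.
Qed.

End Riemann.

(** * Translation invariance and bounds for Riemann sums *)

Section Shift.
Variables (R : realType) (n : nat).
Notation V := 'rV[R]_n.
Implicit Types (f g F : V -> R) (x y : V) (m : nat).

Lemma evec_coord i j : (evec R i : V) 0 j = (j == i)%:R.
Proof. by rewrite mxE eqxx /=. Qed.

(** A cyclic shift of the i-th index permutes the grid. Only its wrap-around is not a translation:
    there the two arguments have i-th coordinates 2 and -2, where [F] vanishes. *)
Lemma rsum_shift m F i : (forall x, 2 <= `|x 0 i| -> F x = 0) ->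
  rsum m (fun x => F (x + 2 ^- m *: evec R i)) = rsum m F.
Proof.
move=> F0; rewrite /rsum; congr (_ * _).
pose sh (k : {ffun 'I_n -> 'I_(2 ^ (m + 2))}) : {ffun 'I_n -> 'I_(2 ^ (m + 2))} :=
  [ffun j => if j == i then ordS (k j) else k j].
pose sh' (k : {ffun 'I_n -> 'I_(2 ^ (m + 2))}) : {ffun 'I_n -> 'I_(2 ^ (m + 2))} :=
  [ffun j => if j == i then ord_pred (k j) else k j].
have shK : cancel sh sh'.
  by move=> k; apply/ffunP => j; rewrite !ffunE; case: eqP => // _; rewrite ordSK.
have shK' : cancel sh' sh.
  by move=> k; apply/ffunP => j; rewrite !ffunE; case: eqP => // _; rewrite ord_predK.
rewrite [RHS](reindex sh); last by exists sh' => k _.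
apply: eq_bigr => k _.
have [kN|kN] := eqVneq ((k i).+1) (2 ^ (m + 2))%N.
  rewrite !F0 //.
    by rewrite !mxE ffunE eqxx /= kN modnn mulr0 addr0 normrN normr_nat.
  have E : 2 ^- m * ((k i)%:R + 1) = 4 :> R by rewrite natr1 kN step_mulX.
  by rewrite !mxE !eqxx /= mulr1 ger0_norm; lra.
congr F; apply/rowP => j; rewrite !mxE ffunE eqxx /=.
have [->|ji] := eqVneq j i; last by rewrite mulr0 addr0.
have hk : ((k i).+1 < 2 ^ (m + 2))%N by rewrite ltn_neqAle kN ltn_ord.
by rewrite /= modn_small // -[(k i).+1%:R]natr1 mulrDr mulr1 addrA.
Qed.

Lemma rsum_shiftn m l F i (c : R) : (forall x, c <= `|x 0 i| -> F x = 0) ->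
  c + l%:R * 2 ^- m <= 2 ->
  rsum m (fun x => F (x + (l%:R * 2 ^- m) *: evec R i)) = rsum m F.
Proof.
move=> F0; have s0 := step_gt0 R m; elim: l => [|l IH] hl.
  by rewrite /rsum; under eq_bigr do rewrite mul0r scale0r addr0.
rewrite -IH; last by move: hl; rewrite -[l.+1%:R]natr1 mulrDl mul1r; lra.
rewrite -[RHS](@rsum_shift m _ i).
  congr (rsum _ _); apply/funext => x; congr F.
  by rewrite -addrA -scalerDl -[l.+1%:R]natr1 mulrDl mul1r [_ + 2 ^- m]addrC.
move=> x hx; apply: F0; rewrite !mxE !eqxx mulr1.
have := ler_normB (x 0 i + l%:R * 2 ^- m) (l%:R * 2 ^- m).
rewrite addrK [`|l%:R * _|]ger0_norm ?mulr_ge0 ?(ltW s0)//.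
by move: hl; rewrite -[l.+1%:R]natr1 mulrDl mul1r; lra.
Qed.

(** The Riemann sums with m >= j already agree exactly. Since j > 0 the shift is at most 1/2, so a
    support within 3/2 stays in the cube. *)
Lemma integ_shift j F i : (0 < j)%N -> (forall x, 3 / 2 <= `|x 0 i| -> F x = 0) ->
  integ (fun x => F (x + 2 ^- j *: evec R i)) = integ F.
Proof.
move=> j0 F0; rewrite /integ.
suff jF : \forall m \near ultra,
    rsum m (fun x => F (x + 2 ^- j *: evec R i)) = rsum m F.
  suff -> : (rsum m (fun x => F (x + 2 ^- j *: evec R i)) @[m --> ultra]) =
    (rsum m F @[m --> ultra]) by [].
  by rewrite eqEsubset; split; apply: near_eq_cvg => //; near=> m; apply/esym; near: m.
apply: eventually_sub_ultra; exists j => // m /= jm.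
have E : 2 ^- j = (2 ^ (m - j))%:R * 2 ^- m :> R.
  by rewrite natrX -[in X in _ = _ * X](subnK jm) exprD invfM mulVKf // expf_neq0.
have -> : (fun x => F (x + 2 ^- j *: evec R i)) =
  (fun x => F (x + ((2 ^ (m - j))%:R * 2 ^- m) *: evec R i)) by rewrite -E.
apply: rsum_shiftn F0 _; rewrite -E.
have : 2 ^- j <= 2 ^- 1 :> R by rewrite lef_pV2 ?posrE ?exprn_gt0// ler_weXn2l// ler1n.
by rewrite expr1; lra.
Unshelve. all: end_near. Qed.

Lemma rsum_prod m (phi : 'I_n -> R -> R) :
  rsum m (fun x => \prod_i phi i (x 0 i)) =
  \prod_i (2 ^- m * \sum_(k < 2 ^ (m + 2)) phi i (-2 + 2 ^- m * k%:R)).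
Proof.
rewrite big_split /= prodr_const card_ord bigA_distr_bigA /=.
rewrite /rsum; congr (_ * _); apply: eq_bigr => k _.
by apply: eq_bigr => i _; rewrite mxE.
Qed.

(** Up to a constant, the antiderivative of the indicator of [a, b]; it is the telescoping
    comparison function for [sum1_le] and [sum1_ge]. *)
Definition clamp (a b s : R) := Num.max a (Num.min b s).

Lemma clampL a b s : s <= a -> clamp a b s = a.
Proof. by move=> sa; rewrite /clamp max_l // ge_min sa orbT. Qed.

Lemma clampR a b s : a <= b -> b <= s -> clamp a b s = b.
Proof. by move=> ab bs; rewrite /clamp min_l // max_r. Qed.

Lemma clampM a b s : a <= s -> s <= b -> clamp a b s = s.
Proof. by move=> ab bs; rewrite /clamp min_r // max_r. Qed.

Lemma clamp_lip a b s t : a <= b -> s <= t -> clamp a b t - clamp a b s <= t - s.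
Proof.
move=> ab st; have [ta|ta] := leP t a.
  by rewrite !clampL ?subrr ?subr_ge0 //; exact: le_trans ta.
have [bs|bs] := leP b s.
  by rewrite !clampR ?subrr ?subr_ge0 //; exact: le_trans st.
have [tb|tb] := leP t b; have [sa|sa] := leP s a.
- by rewrite (clampM (ltW ta) tb) (clampL _ sa) lerB.
- by rewrite !clampM // ltW.
- by rewrite (clampR ab (ltW tb)) (clampL _ sa) lerB // ltW.
- by rewrite (clampR ab (ltW tb)) (clampM (ltW sa) (ltW bs)) lerB // ltW.
Qed.

(* Comparing a Riemann sum with a telescoping one avoids counting grid points. *)
Lemma sum1_le m (phi : R -> R) (Psi : R -> R) :
  (forall s, 2 ^- m * phi s <= Psi (s + 2 ^- m) - Psi s) ->
  2 ^- m * \sum_(k < 2 ^ (m + 2)) phi (-2 + 2 ^- m * k%:R) <= Psi 2 - Psi (-2).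
Proof.
move=> h; rewrite mulr_sumr.
have -> : Psi 2 - Psi (-2) =
    \sum_(k < 2 ^ (m + 2)) (Psi (-2 + 2 ^- m * k.+1%:R) - Psi (-2 + 2 ^- m * k%:R)).
  rewrite -(big_mkord xpredT (fun k => Psi (-2 + 2 ^- m * k.+1%:R) - Psi (-2 + 2 ^- m * k%:R))).
  rewrite telescope_sumr // mulr0 addr0 step_mulX; congr (Psi _ - _); lra.
apply: ler_sum => k _; apply: le_trans (h _) _.
by rewrite -[k.+1%:R]natr1 mulrDr mulr1 addrA.
Qed.

Lemma sum1_ge m (phi : R -> R) (Psi : R -> R) :
  (forall s, Psi (s + 2 ^- m) - Psi s <= 2 ^- m * phi s) ->
  Psi 2 - Psi (-2) <= 2 ^- m * \sum_(k < 2 ^ (m + 2)) phi (-2 + 2 ^- m * k%:R).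
Proof.
move=> h; have := @sum1_le m (fun s => - phi s) (fun s => - Psi s).
rewrite sumrN mulrN => H; suff : - (2 ^- m * \sum_(k < 2 ^ (m + 2)) phi (-2 + 2 ^- m * k%:R)) <=
  - Psi 2 - - Psi (-2) by lra.
by apply: H => s; have := h s; lra.
Qed.

Lemma step_le h : 0 < h -> \forall m \near \oo, 2 ^- m <= h :> R.
Proof.
move=> h0; have := @cvg_geometric R 1 (2^-1).
rewrite ger0_norm ?invr_ge0// invf_lt1 ?ltr1n// => /(_ isT)/cvgr0Pnorm_le/(_ _ h0).
apply: filterS => m; rewrite /geometric /= mul1r ger0_norm ?exprn_ge0 ?invr_ge0//.
by rewrite exprVn.
Qed.

Lemma prod_bound (phi : 'I_n -> R -> R) :
  (forall i s, 0 <= phi i s <= 1) -> forall x, 0 <= \prod_i phi i (x 0 i) <= 1.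
Proof. 
move=> h x; apply/andP; split; last by apply: prodr_ile1 => i _; exact: h.
by apply: prodr_ge0 => i _; case/andP: (h i (x 0 i)).
Qed.

(** Equal to 1 for |s - c| <= h and to 0 for |s - c| >= 2 h. The cubes of a null cover are replaced
    by such continuous majorants so that a compactness argument applies to them. *)
Definition tent (c h s : R) : R := clamp 0 1 (2 - `|s - c| / h).

Lemma tent_bound c h s : 0 <= tent c h s <= 1.
Proof.
rewrite /tent /clamp; set t := 2 - _.
by rewrite le_max lexx /= ge_max ler01 ge_min lexx.
Qed.

Definition plateau (c : V) (h : R) (x : V) : R := \prod_i tent (c 0 i) h (x 0 i).

Lemma plateau_bound c h x : 0 <= plateau c h x <= 1.
Proof. by apply: (@prod_bound (fun i => tent (c 0 i) h)) => i s; exact: tent_bound. Qed.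

Lemma plateau1 c h x : 0 < h -> cube c h x -> plateau c h x = 1.
Proof.
move=> h0 cx; rewrite /plateau big1 // => i _; rewrite /tent /clamp.
have : `|x 0 i - c 0 i| / h < 1 by rewrite ltr_pdivrMr// mul1r; exact: cx.
by move=> ?; rewrite min_l ?max_r//; lra.
Qed.

(** The support has length 4 h; widening it by h at both ends absorbs one grid step, whence 6 h. *)
Lemma tent_sum c h m : 0 < h -> 2 ^- m <= h ->
  2 ^- m * \sum_(k < 2 ^ (m + 2)) tent c h (-2 + 2 ^- m * k%:R) <= 6 * h.
Proof.
move=> h0 mh; have s0 := step_gt0 R m; set t := 2 ^- m in mh s0 *.
pose Psi s := clamp (c - 3 * h) (c + 3 * h) s.
have -> : 6 * h = (c + 3 * h) - (c - 3 * h) by lra.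
apply: le_trans (_ : Psi 2 - Psi (-2) <= _).
  apply: sum1_le => s; rewrite -/t.
  have [hs|hs] := leP (`|s - c|) (2 * h).
    have /andP[_ t1] := tent_bound c h s.
    apply: (@le_trans _ _ t); first by rewrite -{2}[t]mulr1 ler_wpM2l// ltW.
    move: hs; rewrite ler_norml => /andP[? ?].
    by rewrite /Psi !clampM; lra.
  have -> : tent c h s = 0.
    rewrite /tent /clamp; have : 2 < `|s - c| / h by rewrite ltr_pdivlMr.
    by move=> ?; rewrite max_l // ge_min; apply/orP; right; lra.
  rewrite mulr0 subr_ge0 /Psi /clamp; apply: le_max2 => //.
  by apply: le_min2 => //; lra.
rewrite lerB //; rewrite /Psi /clamp.
  by rewrite ge_max ge_min lexx /= andbT; lra.
by rewrite le_max lexx.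
Qed.

Lemma integ_plateau c h : 0 < h -> integ (plateau c h) <= (6 * h) ^+ n.
Proof.
move=> h0; apply: limr_le.
  by apply: rsum_cvg; exists 1 => x _; rewrite ger0_norm; case/andP: (plateau_bound c h x).
apply: eventually_sub_ultra; apply: filterS (step_le h0) => m mh.
rewrite [leLHS](rsum_prod m (fun i => tent (c 0 i) h)).
rewrite -[n in leRHS]card_ord -prodr_const; apply: ler_prod => i _.
rewrite tent_sum // andbT mulr_ge0 ?invr_ge0 ?exprn_ge0//.
by apply: sumr_ge0 => k _; case/andP: (tent_bound (c 0 i) h (-2 + 2 ^- m * k%:R)).
Qed.

Lemma integ_lower f (c : V) (d a : R) :
  0 < d -> d <= 1 -> (forall i, `|c 0 i| <= 1) -> bdd f -> 0 <= a ->
  (forall x, `|x| <= 2 -> 0 <= f x) ->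
  (forall x, `|x| <= 2 -> (forall i, `|x 0 i - c 0 i| <= d) -> a <= f x) ->
  a * d ^+ n <= integ f.
Proof.
move=> d0 d1 c1 bf a0 f0 fa.
pose phi i s : R := (`|s - c 0 i| <= d)%R%:R.
apply: limr_ge; first exact: rsum_cvg.
have d20 : 0 < d / 2 by lra.
apply: eventually_sub_ultra; apply: filterS (step_le d20) => m mh.
have s0 := step_gt0 R m.
apply: (@le_trans _ _ (rsum m (fun x => a * \prod_i phi i (x 0 i)))); last first.
  apply: le_rsum => x x2.
  have [cx|] := boolP [forall i, `|x 0 i - c 0 i| <= d].
    move/forallP in cx; rewrite big1 ?mulr1; first exact: fa.
    by move=> i _; rewrite /phi cx.
  rewrite negb_forall => /existsP[i hi]; rewrite (bigD1 i)//= {1}/phi (negbTE hi).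
  by rewrite mul0r mulr0; exact: f0.
rewrite rsumZ ler_wpM2l// rsum_prod -[n in leLHS]card_ord -prodr_const.
apply: ler_prod => i _; rewrite ltW //=.
have := c1 i; rewrite ler_norml => /andP[? ?].
(* The middle half of the interval, of length d, leaves a margin d / 2 for one grid step; the bounds
   on [c] and [d] keep it inside [-2, 2]. *)
pose Psi s := clamp (c 0 i - d / 2) (c 0 i + d / 2) s.
have pq : c 0 i - d / 2 <= c 0 i + d / 2 by lra.
have -> : d = Psi 2 - Psi (-2) by rewrite /Psi clampR ?clampL //; lra.
apply: sum1_ge => s; rewrite /phi; have [hs|] := leP `|s - c 0 i| d; rewrite /= ?mulr1 ?mulr0.
  have := @clamp_lip _ _ s (s + 2 ^- m) pq.
  by rewrite lerDl (ltW s0) /Psi => /(_ isT); lra.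
rewrite ltr_normr => /orP[] hs; rewrite /Psi.
  by rewrite !clampR ?subrr //; lra.
by rewrite !clampL ?subrr //; lra.
Qed.

End Shift.

Section Bdd.
Variables (R : realType) (n : nat).
Notation V := 'rV[R]_n.
Implicit Types (f g : V -> R).

Lemma bdd_cst c : bdd (fun _ : V => c : R).
Proof. by exists `|c|. Qed.

Lemma bddD f g : bdd f -> bdd g -> bdd (fun x => f x + g x).
Proof.
move=> [C fC] [D gD]; exists (C + D) => x hx.
by apply: le_trans (ler_normD _ _) _; rewrite lerD ?fC ?gD.
Qed.

Lemma bddN f : bdd f -> bdd (fun x => - f x).
Proof. by move=> [C fC]; exists C => x hx; rewrite normrN fC. Qed.

Lemma bddM f g : bdd f -> bdd g -> bdd (fun x => f x * g x).
Proof.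
move=> [C fC] [D gD]; exists (C * D) => x hx.
by rewrite normrM ler_pM ?fC ?gD.
Qed.

Lemma bddX f k : bdd f -> bdd (fun x => f x ^+ k).
Proof.
move=> [C fC]; exists (C ^+ k) => x hx; rewrite normrX lerXn2r ?nnegrE ?fC //.
exact: le_trans (fC _ hx).
Qed.

Lemma bdd_sum (I : Type) (r : seq I) (f : I -> V -> R) :
  (forall i, bdd (f i)) -> bdd (fun x => \sum_(i <- r) f i x).
Proof.
move=> h; elim: r => [|i r IH].
  by under eq_fun do rewrite big_nil; exact: bdd_cst.
by under eq_fun do rewrite big_cons; exact: bddD.
Qed.

Lemma bdd_range f (a b : R) : (forall x, `|x| <= 2 -> a <= f x <= b) -> bdd f.
Proof.
move=> h; exists (`|a| + `|b|) => x /h /andP[ha hb].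
have := ler_norm (- a); have := ler_norm b; rewrite normrN => hb' ha'.
have := normr_ge0 a; have := normr_ge0 b => b0 a0.
by rewrite ler_norml; apply/andP; split; lra.
Qed.

Lemma bdd_coord i : bdd (fun x : V => x 0 i).
Proof. by exists 2 => x; apply: le_trans; exact: coord_le_norm. Qed.

Lemma integB f g : bdd f -> bdd g ->
  integ (fun x => f x - g x) = integ f - integ g.
Proof.
move=> bf bg; rewrite integD //; last exact: bddN.
by congr (_ + _); under eq_fun do rewrite -mulN1r; rewrite integZ // mulN1r.
Qed.

Lemma integ_sum (I : Type) (r : seq I) (f : I -> V -> R) : (forall i, bdd (f i)) ->
  integ (fun x => \sum_(i <- r) f i x) = \sum_(i <- r) integ (f i).
Proof.
move=> h; elim: r => [|i r IH].
  by under eq_fun do rewrite big_nil; rewrite big_nil integ_cst mul0r.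
by under eq_fun do rewrite big_cons; rewrite big_cons -IH integD //; exact: bdd_sum.
Qed.

End Bdd.

Ltac bdd1 :=
  lazymatch goal with
  | |- bdd (fun x => @?f x + @?g x) => apply: (@bddD _ _ f g)
  | |- bdd (fun x => - @?f x) => apply: (@bddN _ _ f)
  | |- bdd (fun x => @?f x * @?g x) => apply: (@bddM _ _ f g)
  | |- bdd (fun x => @?f x ^+ ?k) => apply: (@bddX _ _ f k)
  | |- bdd (fun x => ?c) => apply: bdd_cst
  end.
Ltac bdd_tac := repeat (try assumption; bdd1); try assumption.

(** * Daniell's argument for continuous functions tending to 0 off a null set *)

Section Daniell.
Variables (R : realType) (n : nat).
Notation V := 'rV[R]_n.

Lemma tent_continuous (c h : R) : continuous (tent c h).
Proof.
move=> s; have : {for s, continuous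
    ((fun=> 0) \max ((fun=> 1) \min (fun s => 2 - `|s - c| / h : R)))}.
  apply: continuous_max; first exact: cvg_cst.
  apply: continuous_min; first exact: cvg_cst.
  apply: cvgB; first exact: cvg_cst.
  by apply: cvgMl; apply: cvg_norm; apply: cvgB; [exact: cvg_id|exact: cvg_cst].
exact.
Qed.

Lemma plateau_continuous (c : V) h : continuous (plateau c h).
Proof.
apply: (@continuous_big R 'I_n _ _ _ (@mul_continuous R)) => i _ x.
apply: (@continuous_comp V R R (fun y : V => y 0 i)); first exact: coord_continuous.
exact: tent_continuous.
Qed.

Lemma half_geom_sum m : \sum_(j < m) 2 ^- j.+2 <= 2^-1 :> R.
Proof.
suff -> : \sum_(j < m) 2 ^- j.+2 = 2^-1 - 2 ^- m.+1 :> R.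
  by rewrite lerBlDr lerDl ltW ?step_gt0.
elim: m => [|m IH]; first by rewrite big_ord0 expr1 subrr.
rewrite big_ord_recr /= IH -addrA; congr (_ + _).
by rewrite [2 ^+ m.+2]exprS invfM; lra.
Qed.

Section Sequence.
Variables (g : nat -> V -> R) (C : R).
Hypothesis gC : forall k x, `|x| <= 2 -> 0 <= g k x <= C.
Hypothesis gcont : forall k x, `|x| <= 2 -> {for x, continuous (g k)}.

(** Finite maxima stay continuous, which the supremum of a whole tail may fail to be; the supremum
    of their integrals is approached at finite [l]. *)
Fixpoint tmax m l : V -> R :=
  if l is l'.+1 then tmax m l' \max g (m + l)%N else g m.

Lemma tmax_bound m l x : `|x| <= 2 -> 0 <= tmax m l x <= C.
Proof.
move=> hx; elim: l => [|l /andP[h1 h2]] /=; first exact: gC.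
by have /andP[h3 h4] := gC (m + l.+1) hx; rewrite le_max h1 ge_max h2 h4.
Qed.

Lemma tmax_cont m l x : `|x| <= 2 -> {for x, continuous (tmax m l)}.
Proof.
move=> hx; elim: l => [|l IH] /=; first exact: gcont.
by apply: continuous_max IH _; exact: gcont.
Qed.

Lemma le_tmax m l k x : (m <= k <= m + l)%N -> g k x <= tmax m l x.
Proof.
elim: l => [|l IH] /=; first by rewrite addn0 -eqn_leq => /eqP ->.
rewrite le_max => /andP[mk]; rewrite leq_eqVlt => /predU1P[->|].
  by rewrite lexx orbT.
by rewrite addnS ltnS => h; rewrite IH // mk h.
Qed.

Lemma tmax_le m l x d : (forall k, (m <= k <= m + l)%N -> g k x <= d) -> tmax m l x <= d.
Proof.
elim: l => [|l IH] h /=; first by apply: h; rewrite leqnn leq_addr.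
rewrite ge_max IH ?h ?leq_addr ?leqnn // => k /andP[h1 h2].
by apply: h; rewrite h1 (leq_trans h2) // leq_add2l.
Qed.

Lemma bdd_tmax m l : bdd (tmax m l).
Proof. by apply: (@bdd_range _ _ _ 0 C) => x; exact: tmax_bound. Qed.

Let tset m := [set integ (tmax m l) | l in [set: nat]].

Lemma tset_sup m : has_sup (tset m).
Proof.
split; first by exists (integ (tmax m 0)); exists 0%N.
exists (C * 4 ^+ n) => _ [l _ <-]; rewrite -integ_cst.
apply: le_integ; [exact: bdd_tmax|exact: bdd_cst|].
by move=> x /(tmax_bound m l)/andP[].
Qed.

(* Daniell's argument: the decreasing functions [G] lose only [e / 2] of integral against
   the tail maxima [F], and Dini's theorem applies to [G] outside the cover of [N]. *)
Lemma daniell (N : set V) e : Defs.null_set N ->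
  (forall x, `|x| <= 2 -> ~ N x -> forall d, 0 < d ->
    exists m, forall k, (m <= k)%N -> g k x <= d) ->
  0 < e -> (forall k, e <= integ (g k)) -> False.
Proof.
move=> N0 gN e0 ge.
(* [F m] will exhaust the tail from m on up to e 2^-(m+2); these losses add up to at most e / 2. *)
have /choice[l lP] m : exists l, sup (tset m) - e * 2 ^- m.+2 < integ (tmax m l).
  have [||_ [l _ <-] hl] := @sup_adherent R (tset m) (e * 2 ^- m.+2).
  - by rewrite mulr_gt0 ?step_gt0.
  - exact: tset_sup.
  - by exists l.
pose F m := tmax m (l m).
pose G := fix G m := if m is m'.+1 then G m' \min F m else F 0%N.
have bF m : bdd (F m) by exact: bdd_tmax.
have Gb m x : `|x| <= 2 -> 0 <= G m x <= C.
  move=> hx; elim: m => [|m /andP[h1 h2]] /=; first exact: tmax_bound.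
  by have /andP[h3 h4] := tmax_bound m.+1 (l m.+1) hx; rewrite le_min h1 h3 ge_min h2.
have bG m : bdd (G m) by apply: (@bdd_range _ _ _ 0 C) => x; exact: Gb.
have GF m x : G m x <= F m x by case: m => [|m] //=; rewrite ge_min lexx orbT.
have Gdec m k x : (m <= k)%N -> G k x <= G m x.
  move=> /subnKC <-; elim: (k - m)%N => [|j IH]; first by rewrite addn0.
  by rewrite addnS /= ge_min IH.
have Gcont m x : `|x| <= 2 -> {for x, continuous (G m)}.
  move=> hx; elim: m => [|m IH] /=; first exact: tmax_cont.
  by apply: continuous_min IH _; exact: tmax_cont.
have bmaxF m j : bdd (fun x => Num.max (F m x) (F j x)).
  apply: (@bdd_range _ _ _ 0 C) => x hx.
  have /andP[h1 h2] := tmax_bound m (l m) hx; have /andP[h3 h4] := tmax_bound j (l j) hx.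
  by rewrite le_max h1 ge_max h2 h4.
(* For j <= m the maximum of [F m] and [F j] lies below a finite tail maximum starting at j, so its
   integral is at most the supremum that [F j] nearly attains. *)
have Fmax m j : (j <= m)%N ->
    integ (fun x => Num.max (F m x) (F j x) - F j x) <= e * 2 ^- j.+2.
  move=> jm; rewrite integB // lerBlDr.
  apply: (@le_trans _ _ (sup (tset j))); last by have := lP j; rewrite -/(F j); lra.
  pose L := (m - j + l m + l j)%N.
  apply: (@le_trans _ _ (integ (tmax j L))); last first.
    by apply: (sup_upper_bound (tset_sup j)); exists L.
  apply: le_integ => //; first exact: bdd_tmax.
  move=> x hx; rewrite ge_max; apply/andP; split; apply: tmax_le => k /andP[h1 h2].
    apply: le_tmax; rewrite (leq_trans jm h1) /=; rewrite /L; lia.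
  by apply: le_tmax; rewrite h1 /= /L; lia.
have FG m : integ (F m) - integ (G m) <= e / 2.
  rewrite -integB //.
  apply: (@le_trans _ _ (\sum_(j < m.+1) e * 2 ^- j.+2)); last first.
    by rewrite -mulr_sumr ler_wpM2l ?half_geom_sum // ltW.
  apply: (@le_trans _ _ (integ (fun x => \sum_(j < m.+1) (Num.max (F m x) (F j x) - F j x)))).
    apply: le_integ; first by bdd_tac.
      by apply: (@bdd_sum _ _ 'I_m.+1 _ (fun j x => Num.max (F m x) (F j x) - F j x)) => j; bdd_tac.
    move=> x hx.
    suff : forall m', F m x - G m' x <= \sum_(j < m'.+1) (Num.max (F m x) (F j x) - F j x) by [].
    elim=> [|m' IH]; first by rewrite big_ord1 /= lerB // le_max lexx.
    rewrite big_ord_recr /=.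
    have h0 : 0 <= Num.max (F m x) (F m'.+1 x) - F m'.+1 x.
      by rewrite subr_ge0 le_max lexx orbT.
    have h1 : 0 <= \sum_(j < m'.+1) (Num.max (F m x) (F j x) - F j x).
      by apply: sumr_ge0 => j _; rewrite subr_ge0 le_max lexx orbT.
    rewrite /Num.min; case: ifP => _; first by apply: le_trans IH _; rewrite lerDl.
    by rewrite -[leLHS]add0r lerD // lerB // le_max lexx.
  rewrite (@integ_sum _ _ 'I_m.+1 _ (fun j x => Num.max (F m x) (F j x) - F j x)).
    by apply: ler_sum => j _; apply: Fmax; rewrite -ltnS.
  by move=> j; bdd_tac.
have IG m : e / 2 <= integ (G m).
  have := FG m; suff : e <= integ (F m) by lra.
  apply: le_trans (ge m) _; apply: le_integ => //.
    by apply: (@bdd_range _ _ _ 0 C) => x; exact: gC.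
  by move=> x _; apply: le_tmax; rewrite leqnn leq_addr.
have C0 : 0 <= C.
  by have /andP[+ +] := @gC 0%N 0 ltac:(by rewrite normr0); exact: le_trans.
have c3 : 0 < 3 ^+ n :> R by rewrite exprn_gt0.
have c4 : 0 < 4 ^+ n :> R by rewrite exprn_gt0.
(* A [plateau] integrates to at most 3^n times the volume of its cube, so this volume budget keeps
   the integral of [H m] below e / 8. *)
pose d := e / (8 * (C + 1) * 3 ^+ n).
have d0 : 0 < d by rewrite divr_gt0 // !mulr_gt0 //; lra.
have [c [h [h0 [Nc hd]]]] := N0 _ d0.
pose H m x := C * \sum_(k < m) plateau (c k) (h k) x.
have bb k : bdd (plateau (c k) (h k)).
  by apply: (@bdd_range _ _ _ 0 1) => x _; exact: plateau_bound.
have bS m : bdd (fun x => \sum_(k < m) plateau (c k) (h k) x).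
  exact: (@bdd_sum _ _ 'I_m _ (fun k => plateau (c k) (h k))).
have bH m : bdd (H m) by rewrite /H; bdd_tac; exact: bS.
have IH m : integ (H m) <= e / 8.
  rewrite /H integZ //.
  rewrite (@integ_sum _ _ 'I_m _ (fun k => plateau (c k) (h k))) //.
  apply: (@le_trans _ _ (C * (3 ^+ n * d))).
    rewrite ler_wpM2l //.
    apply: le_trans (_ : 3 ^+ n * \sum_(k < m) (2 * h k) ^+ n <= _); last by rewrite ler_pM2l.
    rewrite mulr_sumr; apply: ler_sum => k _; rewrite -exprMn.
    by apply: le_trans (integ_plateau _ (h0 k)) _; rewrite mulrA -natrM.
  rewrite /d; have -> : C * (3 ^+ n * (e / (8 * (C + 1) * 3 ^+ n))) = e / 8 * (C / (C + 1)).
    by field; rewrite !gt_eqF //; lra.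
  rewrite -[leRHS]mulr1 ler_wpM2l //; first by lra.
  by rewrite ler_pdivrMr; lra.
have Hinc m k x : (m <= k)%N -> H m x <= H k x.
  move=> /subnKC <-; elim: (k - m)%N => [|j IHj]; first by rewrite addn0.
  apply: le_trans IHj _; rewrite addnS /H big_ord_recr /= ler_wpM2l // lerDl.
  by case/andP: (plateau_bound (c (m + j)%N) (h (m + j)%N) x).
have Hcont m : continuous (H m).
  have cS : continuous (fun x => \sum_(k < m) plateau (c k) (h k) x).
    apply: (@continuous_big R 'I_m _ _ _ (@add_continuous R)) => i _.
    exact: plateau_continuous.
  by move=> x; have := @cvgMr _ _ _ _ _ C _ (cS x); apply.
pose e' := e / (8 * 4 ^+ n).
have e'0 : 0 < e' by rewrite divr_gt0 // mulr_gt0.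
(* Otherwise points violating the bound cluster at some x of the compact cube. Either x lies in a
   cube of the cover, where [H] reaches [C], or [g] tends to 0 at x. Both give [G m0 < H m0 + e']
   near x, and this persists for larger m since [G] decreases and [H] increases. *)
have [m Gm] : exists m, forall x, `|x| <= 2 -> G m x <= H m x + e'.
  apply: contrapT => /forallNP nG.
  have /choice[p pP] m : exists x : V, `|x| <= 2 /\ H m x + e' < G m x.
    move: (nG m) => /existsNP[x /not_implyP[hx /negP]]; rewrite -ltNge => ?.
    by exists x.
  have cQ : compact [set x : V | `|x| <= 2].
    apply: bounded_closed_compact.
      by exists 2; split; [exact: num_real|move=> M M2 x /= /le_trans; apply; exact: ltW].
    have -> : [set x : V | `|x| <= 2] = (fun x : V => `|x|) @^-1` [set t | t <= 2] by [].
    apply: closed_comp; last exact: closed_le.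
    by move=> x _; exact: norm_continuous.
  have pQ : (p @ \oo) [set x : V | `|x| <= 2] by exists 0%N => // m _; case: (pP m).
  have [x [/= hx clx]] := cQ _ _ pQ.
  have [m0 hm0] : exists m0, G m0 x < H m0 x + e'.
    have [Nx|Nx] := pselect (N x).
      have [k _ kx] := Nc _ Nx; exists k.+1.
      have /andP[_ Gx] := Gb k.+1 _ hx.
      apply: le_lt_trans Gx _; rewrite -[ltLHS]addr0 ler_ltD //.
      rewrite /H big_ord_recr /= plateau1 // -[leLHS]mulr1 ler_wpM2l // lerDr.
      by apply: sumr_ge0 => j _; case/andP: (plateau_bound (c j) (h j) x).
    have e'2 : 0 < e' / 2 by lra.
    have [m0 hm] := gN x hx Nx _ e'2; exists m0.
    apply: (@le_lt_trans _ _ (e' / 2)).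
      by apply: le_trans (GF _ _) _; apply: tmax_le => k /andP[/hm].
    apply: (@lt_le_trans _ _ e'); first by lra.
    rewrite lerDr /H mulr_ge0 //.
    by apply: sumr_ge0 => j _; case/andP: (plateau_bound (c j) (h j) x).
  have nA : nbhs x [set y | 0 < H m0 y + e' - G m0 y].
    have : (H m0 y + e' - G m0 y) @[y --> x] --> H m0 x + e' - G m0 x.
      by have := cvgB (cvgD (Hcont m0 x) (@cvg_cst _ e' _ _ _)) (Gcont m0 x hx); apply.
    move=> /cvgr_gt; apply; lra.
  have pA : (p @ \oo) [set y | exists2 m, (m0 <= m)%N & y = p m].
    by exists m0 => // m /= hm; exists m.
  have [_ [[m hm ->] /= hA]] := clx _ _ pA nA.
  have [_ hp] := pP m; have := Gdec _ _ (p m) hm; have := Hinc _ _ (p m) hm; lra.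
have : integ (G m) <= e / 8 + e' * 4 ^+ n.
  apply: le_trans (_ : integ (fun x => H m x + e') <= _).
    by apply: le_integ => //; bdd_tac; exact: bH.
  by rewrite integD //; [rewrite integ_cst lerD2r|bdd_tac].
have -> : e' * 4 ^+ n = e / 8 by rewrite /e'; field; rewrite gt_eqF.
by have := IG m; lra.
Unshelve. all: end_near. Qed.

End Sequence.

End Daniell.

(** * First-order jets and the weak Laplacian *)

Section Jets.
Variables (R : realType) (n : nat).
Notation V := 'rV[R]_n.
Implicit Types (f : V -> R) (g : V -> V) (x y z : V) (c K : R).

Definition dot x y : R := \sum_i x 0 i * y 0 i.

Lemma dotC x y : dot x y = dot y x.
Proof. by apply: eq_bigr => i _; rewrite mulrC. Qed.

Lemma dotDl x y z : dot (x + y) z = dot x z + dot y z.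
Proof. by rewrite -big_split; apply: eq_bigr => i _; rewrite mxE mulrDl. Qed.

Lemma dotZl c x y : dot (c *: x) y = c * dot x y.
Proof. by rewrite mulr_sumr; apply: eq_bigr => i _; rewrite mxE mulrA. Qed.

Lemma dotDr x y z : dot z (x + y) = dot z x + dot z y.
Proof. by rewrite dotC dotDl !(dotC z). Qed.

Lemma dotZr c x y : dot x (c *: y) = c * dot x y.
Proof. by rewrite dotC dotZl dotC. Qed.

Lemma dotNl x y : dot (- x) y = - dot x y.
Proof. by rewrite -scaleN1r dotZl mulN1r. Qed.

Lemma dotNr x y : dot x (- y) = - dot x y.
Proof. by rewrite -scaleN1r dotZr mulN1r. Qed.

Lemma dot_evec x i : dot x (evec R i) = x 0 i.
Proof.
rewrite /dot (bigD1 i) //= big1 ?evec_coord ?eqxx ?mulr1 ?addr0 // => j ji.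
by rewrite evec_coord (negbTE ji) mulr0.
Qed.

Lemma dot_ge0 x : 0 <= dot x x.
Proof. by apply: sumr_ge0 => i _; rewrite -expr2 sqr_ge0. Qed.

Lemma norm_dot x y : `|dot x y| <= n%:R * (`|x| * `|y|).
Proof.
apply: le_trans (ler_norm_sum _ _ _) _.
apply: (@le_trans _ _ (\sum_(i < n) `|x| * `|y|)).
  by apply: ler_sum => i _; rewrite normrM ler_pM // coord_le_norm.
by rewrite sumr_const card_ord mulr_natl.
Qed.

Lemma norm_mulmx x (A : 'M[R]_n) : `|x *m A| <= n%:R * (`|x| * `|A|).
Proof.
apply/norm_leP => [|i]; first by rewrite !mulr_ge0.
rewrite mxE; apply: le_trans (ler_norm_sum _ _ _) _.
apply: (@le_trans _ _ (\sum_(k < n) `|x| * `|A|)).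
  apply: ler_sum => k _; rewrite normrM ler_pM //; first exact: coord_le_norm.
  rewrite [leRHS]/Num.norm /= mx_normrE.
  by apply/bigmax_geP; right => /=; exists (k, i).
by rewrite sumr_const card_ord -[leLHS]mulr_natl.
Qed.

Lemma norm_evec (i : 'I_n) : `|evec R i| <= 1.
Proof.
by apply/norm_leP => // j; rewrite evec_coord; case: eqP; rewrite ?normr1 ?normr0.
Qed.

(** Quantitative C^{1,1} regularity, with [g] as gradient, expressed by the quadratic Taylor bound
    alone. No derivative is taken, so sums, products and dilations reduce to algebra. *)
Definition jet c K f g := forall x y, `|x| <= c -> `|y| <= c ->
  [/\ `|f x| <= K, `|g x| <= K & `|f y - f x - dot (g x) (y - x)| <= K * `|y - x| ^+ 2].

Definition C11 c f g := exists K, jet c K f g.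

Lemma jet_ge0 c K f g : 0 <= c -> jet c K f g -> 0 <= K.
Proof.
move=> c0 /(_ 0 0); rewrite normr0 => /(_ c0 c0)[+ _ _]; exact: le_trans.
Qed.

Lemma jet_lip c K f g : 0 <= c -> jet c K f g -> forall x y, `|x| <= c -> `|y| <= c ->
  `|f y - f x| <= (n%:R * K + 2 * c * K) * `|y - x|.
Proof.
move=> c0 h x y hx hy; have K0 := jet_ge0 c0 h; have [_ gK fT] := h x y hx hy.
have -> : f y - f x = dot (g x) (y - x) + (f y - f x - dot (g x) (y - x)) by ring.
apply: le_trans (ler_normD _ _) _; rewrite mulrDl lerD //.
  by apply: le_trans (norm_dot _ _) _; rewrite -mulrA !ler_wpM2l // ler_wpM2r.
apply: le_trans fT _; rewrite [_ * K]mulrC -mulrA expr2 ler_wpM2l // ler_wpM2r //.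
by apply: le_trans (ler_normB _ _) _; rewrite mulr_natl mulr2n lerD.
Qed.

Lemma C11D c f1 g1 f2 g2 : C11 c f1 g1 -> C11 c f2 g2 ->
  C11 c (fun x => f1 x + f2 x) (fun x => g1 x + g2 x).
Proof.
move=> [K1 h1] [K2 h2]; exists (K1 + K2) => x y hx hy.
have [a1 b1 c1] := h1 x y hx hy; have [a2 b2 c2] := h2 x y hx hy; split.
- by apply: le_trans (ler_normD _ _) _; rewrite lerD.
- by apply: le_trans (ler_normD _ _) _; rewrite lerD.
- have -> : f1 y + f2 y - (f1 x + f2 x) - dot (g1 x + g2 x) (y - x) =
    (f1 y - f1 x - dot (g1 x) (y - x)) + (f2 y - f2 x - dot (g2 x) (y - x)).
    by rewrite dotDl; ring.
  by apply: le_trans (ler_normD _ _) _; rewrite mulrDl lerD.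
Qed.

Lemma C11Z c a f g : C11 c f g -> C11 c (fun x => a * f x) (fun x => a *: g x).
Proof.
move=> [K h]; exists (`|a| * K) => x y hx hy; have [h1 h2 h3] := h x y hx hy; split.
- by rewrite normrM ler_wpM2l.
- by rewrite normrZ ler_wpM2l.
- by rewrite dotZl -!mulrBr normrM -mulrA ler_wpM2l.
Qed.

Lemma C11M c f1 g1 f2 g2 : 0 <= c -> C11 c f1 g1 -> C11 c f2 g2 ->
  C11 c (fun x => f1 x * f2 x) (fun x => f1 x *: g2 x + f2 x *: g1 x).
Proof.
move=> c0 [K1 h1] [K2 h2].
have K10 := jet_ge0 c0 h1; have K20 := jet_ge0 c0 h2.
pose L1 := n%:R * K1 + 2 * c * K1; pose L2 := n%:R * K2 + 2 * c * K2.
have L10 : 0 <= L1 by rewrite addr_ge0 ?mulr_ge0.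
have L20 : 0 <= L2 by rewrite addr_ge0 ?mulr_ge0.
have K12 : 0 <= K1 * K2 by rewrite mulr_ge0.
have L12 : 0 <= L1 * L2 by rewrite mulr_ge0.
exists (2 * (K1 * K2) + L1 * L2) => x y hx hy.
have [a1 b1 t1] := h1 x y hx hy; have [a2 b2 t2] := h2 x y hx hy; split.
- rewrite normrM; apply: (@le_trans _ _ (K1 * K2)); first by rewrite ler_pM.
  by lra.
- apply: (@le_trans _ _ (2 * (K1 * K2))); last by rewrite lerDl.
  apply: le_trans (ler_normD _ _) _; rewrite !normrZ mulr_natl mulr2n.
  by apply: lerD; [|rewrite [leRHS]mulrC]; rewrite ler_pM.
- have -> : f1 y * f2 y - f1 x * f2 x - dot (f1 x *: g2 x + f2 x *: g1 x) (y - x) =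
    f1 x * (f2 y - f2 x - dot (g2 x) (y - x)) + f2 x * (f1 y - f1 x - dot (g1 x) (y - x)) +
    (f1 y - f1 x) * (f2 y - f2 x).
    by rewrite dotDl !dotZl; ring.
  rewrite [leRHS]mulrDl; apply: le_trans (ler_normD _ _) _; apply: lerD.
    apply: le_trans (ler_normD _ _) _; rewrite !normrM.
    have -> : 2 * (K1 * K2) * `|y - x| ^+ 2 =
      K1 * (K2 * `|y - x| ^+ 2) + K2 * (K1 * `|y - x| ^+ 2) by ring.
    by rewrite lerD // ler_pM.
  rewrite normrM expr2 mulrACA; apply: ler_pM => //.
    exact: (jet_lip c0 h1).
  exact: (jet_lip c0 h2).
Qed.

Lemma C11_bdd c f g : 2 <= c -> C11 c f g -> bdd f.
Proof.
move=> c2 [K h]; exists K => x hx; have hx' := le_trans hx c2.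
by have [] := h x x hx' hx'.
Qed.

Lemma C11_bddg c f g i : 2 <= c -> C11 c f g -> bdd (fun x => g x 0 i).
Proof.
move=> c2 [K h]; exists K => x hx; have hx' := le_trans hx c2.
by have [_ + _] := h x x hx' hx'; apply: le_trans; exact: coord_le_norm.
Qed.

Lemma lip_continuous f c L x : `|x| < c -> 0 <= L ->
  (forall y, `|y| <= c -> `|f y - f x| <= L * `|y - x|) -> {for x, continuous f}.
Proof.
move=> hx L0 h; apply/(@cvgrPdist_le _ _ _ _ (nbhs_filter x)) => e e0.
have d0 : 0 < Num.min (c - `|x|) (e / (L + 1)).
  by rewrite lt_min subr_gt0 hx divr_gt0 //; lra.
near=> y.
have : `|x - y| < Num.min (c - `|x|) (e / (L + 1)).
  by near: y; apply: cvgr_dist_lt d0; exact: cvg_id.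
rewrite lt_min => /andP[h1 h2]; rewrite distrC.
have yc : `|y| <= c.
  have -> : y = x - (x - y) by rewrite opprB addrCA subrr addr0.
  by apply: le_trans (ler_normB _ _) _; rewrite -lerBrDl ltW.
apply: le_trans (h _ yc) _; rewrite distrC.
apply: (@le_trans _ _ (L * (e / (L + 1)))); first by rewrite ler_wpM2l // ltW.
rewrite mulrA ler_pdivrMr; last by lra.
by rewrite mulrDr mulr1 mulrC lerDl ltW.
Unshelve. all: end_near. Qed.

Lemma norm_integ_le f (M : R) : (forall x, `|x| <= 2 -> `|f x| <= M) ->
  `|integ f| <= M * 4 ^+ n.
Proof.
move=> h; have bf : bdd f by exists M.
rewrite ler_norml -mulNr -!integ_cst; apply/andP; split; apply: le_integ => //;
  try exact: bdd_cst; by move=> x /h; rewrite ler_norml => /andP[].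
Qed.

(** Translation invariance moves the shift from [G] onto [xi], and the first-order expansion of [xi]
    turns the resulting quotient into [- dxi] up to O(2^-j). Of [G] only a bound enters, so it may
    be a component of a Lipschitz gradient. *)
Lemma ibp (xi : V -> R) (dxi : V -> V) (G : V -> R) (C : R) i : C11 3 xi dxi ->
  (forall x, 1 <= `|x 0 i| -> xi x = 0) ->
  (forall x, `|x| <= 3 -> `|G x| <= C) ->
  exists D, forall j, (0 < j)%N ->
  `|integ (fun x => xi x * ((G (x + 2 ^- j *: evec R i) - G x) / 2 ^- j)) +
    integ (fun x => G x * dxi x 0 i)| <= D * 2 ^- j.
Proof.
move=> Cxi xi0 GC; have [K hK] := Cxi.
have K0 : 0 <= K by apply: jet_ge0 hK.
have bxi : bdd xi := C11_bdd (ltW (ltr_nat _ 2 3 : 2 < 3 :> R)) Cxi.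
have bdxi : bdd (fun x => dxi x 0 i).
  exact: C11_bddg (ltW (ltr_nat _ 2 3 : 2 < 3 :> R)) Cxi.
have C0 : 0 <= C by apply: le_trans (GC 0 _); rewrite ?normr0.
exists (C * K * 4 ^+ n) => j j0; set t := 2 ^- j.
have t0 : 0 < t by exact: step_gt0.
have t1 : t <= 1 by rewrite invf_le1 ?exprn_gt0 // exprn_ege1 // ler1n.
have hshift x (s : R) : `|x| <= 2 -> `|s| <= 1 -> `|x + s *: evec R i| <= 3.
  move=> hx hs; apply: le_trans (ler_normD _ _) _.
  rewrite (_ : 3 = 2 + 1); last by lra.
  by rewrite lerD // normrZ mulr_ile1 // norm_evec.
have hle x : `|x| <= 2 -> `|x| <= 3 by move=> ?; lra.
have bG : bdd G by exists C => x /hle; exact: GC.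
have bGt : bdd (fun x => G (x + t *: evec R i)).
  by exists C => x hx; apply: GC; apply: hshift => //; rewrite ger0_norm // ltW.
have bxit : bdd (fun x => xi (x - t *: evec R i)).
  exists K => x hx; suff h : `|x - t *: evec R i| <= 3 by have [] := hK _ _ h h.
  by rewrite -scaleNr; apply: hshift => //; rewrite normrN ger0_norm // ltW.
have E : integ (fun x => xi x * G (x + t *: evec R i)) =
         integ (fun x => xi (x - t *: evec R i) * G x).
  rewrite -[RHS](@integ_shift _ _ j _ i j0) -/t.
    by apply: eq_integ => x _; rewrite addrK.
  move=> x hx; rewrite xi0 ?mul0r // !mxE !eqxx mulr1.
  have := ler_normB (x 0 i - t) (- t); rewrite opprK subrK normrN [`|t|]ger0_norm ?(ltW t0) //.
  suff : t <= 2^-1 by lra.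
  by rewrite lef_pV2 ?posrE ?exprn_gt0 // -{1}[2]expr1 ler_weXn2l // ler1n.
have -> : integ (fun x => xi x * ((G (x + t *: evec R i) - G x) / t)) =
    integ (fun x => t^-1 * (xi (x - t *: evec R i) * G x - xi x * G x)).
  rewrite (@eq_integ _ _ _ (fun x => t^-1 * (xi x * G (x + t *: evec R i) - xi x * G x))).
    by rewrite !integZ ?integB ?E //; bdd_tac.
  by move=> x _; ring.
rewrite -integD; [|by bdd_tac|by bdd_tac].
rewrite mulrAC; apply: norm_integ_le => x hx.
have h3 : `|x - t *: evec R i| <= 3.
  by rewrite -scaleNr; apply: hshift => //; rewrite normrN ger0_norm // ltW.
have [_ _] := hK x (x - t *: evec R i) (hle _ hx) h3.
have -> : x - t *: evec R i - x = - (t *: evec R i) by rewrite addrC addKr.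
rewrite dotNr dotZr dot_evec opprK normrN normrZ.
rewrite -addrA => hT.
have -> : t^-1 * (xi (x - t *: evec R i) * G x - xi x * G x) + G x * dxi x 0 i =
   G x * (t^-1 * (xi (x - t *: evec R i) + (- xi x + t * dxi x 0 i))).
  by rewrite !mulrDr [t^-1 * (t * _)]mulKf ?gt_eqF //; ring.
rewrite normrM -mulrA ler_pM ?GC ?hle // normrM ger0_norm ?invr_ge0 ?(ltW t0) //.
rewrite mulrC ler_pdivrMr //; apply: le_trans hT _.
rewrite -mulrA ler_wpM2l // ger0_norm ?(ltW t0) // exprMn -expr2.
by rewrite -[leRHS]mulr1 ler_wpM2l ?sqr_ge0 // exprn_ile1 // norm_evec.
Qed.

End Jets.

(** * Weak form of the equation and its discretization *)

Section WeakLaplacian.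
Variables (R : realType) (n : nat).
Notation V := 'rV[R]_n.
Implicit Types (xi : V -> R) (dxi g : V -> V) (x y : V).

(** Formally the integral of xi (1 - div g) for compactly supported xi. For g = grad u this
    integrates xi over {grad u = 0}. *)
Definition wlap g xi dxi := integ (fun x => xi x + dot (g x) (dxi x)).

Definition dquot g j x : R :=
  \sum_i (g (x + 2 ^- j *: evec R i) 0 i - g x 0 i) / 2 ^- j.

Definition bddv g := forall i, bdd (fun x => g x 0 i).

Lemma bdd_dot g1 g2 : bddv g1 -> bddv g2 -> bdd (fun x => dot (g1 x) (g2 x)).
Proof.
by move=> h1 h2; apply: (@bdd_sum _ _ _ _ (fun i x => g1 x 0 i * g2 x 0 i)) => i; exact: bddM.
Qed.

Lemma bounded_coord g C i : (forall x, `|x| <= 3 -> `|g x| <= C) ->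
  bdd (fun x => g x 0 i).
Proof.
move=> h; exists C => x hx; apply: le_trans (coord_le_norm _ _) (h _ _).
by apply: le_trans hx _; rewrite ler_nat.
Qed.

Lemma shift_le3 (i : 'I_n) j x : `|x| <= 2 -> `|x + 2 ^- j *: evec R i| <= 3.
Proof.
move=> hx; apply: le_trans (ler_normD _ _) _.
have t0 := step_gt0 R j.
rewrite (_ : 3 = 2 + 1); last by lra.
rewrite lerD // normrZ mulr_ile1 // ?norm_evec // ger0_norm ?(ltW t0) //.
by rewrite invf_le1 ?exprn_gt0 // exprn_ege1 // ler1n.
Qed.

(** The bridge from the weak form to difference quotients, which exist at every point and inherit
    continuity from [g], unlike the second derivatives they approximate. *)
Lemma wlap_dquot g xi dxi C : C11 3 xi dxi ->
  (forall x i, 1 <= `|x 0 i| -> xi x = 0) ->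
  (forall x, `|x| <= 3 -> `|g x| <= C) ->
  exists D, forall j, (0 < j)%N ->
    `|integ (fun x => xi x * (1 - dquot g j x)) - wlap g xi dxi| <= D * 2 ^- j.
Proof.
move=> Cxi xi0 gC.
have gC' i x : `|x| <= 3 -> `|g x 0 i| <= C.
  by move=> hx; apply: le_trans (coord_le_norm _ _) (gC _ hx).
have /choice[D DP] i := ibp Cxi (xi0^~ i) (gC' i).
have h23 : 2 <= 3 :> R by rewrite ler_nat.
have bxi := C11_bdd h23 Cxi.
have bdxi i := C11_bddg i h23 Cxi.
have bg i := bounded_coord i gC.
exists (\sum_i D i) => j j0.
have bq i : bdd (fun x => (g (x + 2 ^- j *: evec R i) 0 i - g x 0 i) / 2 ^- j).
  bdd_tac; last exact: bg.
  exists C => x hx; apply: le_trans (coord_le_norm _ _) (gC _ _).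
  exact: shift_le3.
have -> : integ (fun x => xi x * (1 - dquot g j x)) - wlap g xi dxi =
    - \sum_i (integ (fun x => xi x * ((g (x + 2 ^- j *: evec R i) 0 i - g x 0 i) / 2 ^- j)) +
              integ (fun x => g x 0 i * dxi x 0 i)).
  rewrite big_split /=.
  rewrite -(@integ_sum _ _ 'I_n _ (fun i x => g x 0 i * dxi x 0 i)); last first.
    by move=> i; exact: bddM.
  rewrite -(@integ_sum _ _ 'I_n _ (fun i x =>
     xi x * ((g (x + 2 ^- j *: evec R i) 0 i - g x 0 i) / 2 ^- j))); last first.
    by move=> i; exact: bddM.
  rewrite /wlap integD //; last exact: bdd_dot.
  rewrite !opprD addrA; congr (_ - _).
  rewrite -integB //; last first.
    by apply: bddM => //; apply: bddD; [exact: bdd_cst|apply: bddN; exact: bdd_sum].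
  have -> : forall a : R, - a = -1 * a by move=> a; rewrite mulN1r.
  rewrite -integZ; last first.
    by apply: (@bdd_sum _ _ 'I_n _ (fun i x =>
     xi x * ((g (x + 2 ^- j *: evec R i) 0 i - g x 0 i) / 2 ^- j))) => i; exact: bddM.
  apply: eq_integ => x _; rewrite /dquot -mulr_sumr; ring.
rewrite normrN mulr_suml; apply: le_trans (ler_norm_sum _ _ _) _.
by apply: ler_sum => i _; exact: DP.
Qed.

(* The only place where the equation is used: since it holds almost everywhere,
   the weak Laplacian deficit is a positive functional carried by {g = 0}. *)
Lemma wlap_ge0 g K (N : set V) xi dxi : C11 3 xi dxi ->
  (forall x i, 1 <= `|x 0 i| -> xi x = 0) ->
  (forall x y, `|x| <= 3 -> `|y| <= 3 -> `|g x - g y| <= K * `|x - y|) ->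
  Defs.null_set N ->
  (forall x, `|x| <= 2 -> ~ N x ->
     dquot g j x @[j --> \oo] --> (if g x != 0 then 1 else 0 : R)) ->
  (forall x, `|x| <= 2 -> g x = 0 -> 0 <= xi x) ->
  0 <= wlap g xi dxi.
Proof.
move=> Cxi xi0 gK N0 gN gxi; rewrite leNgt; apply/negP => W0.
have n3 : `|0 : V| <= 3 by rewrite normr0.
have K0' : 0 <= `|K| by [].
have {}gK x y : `|x| <= 3 -> `|y| <= 3 -> `|g x - g y| <= `|K| * `|x - y|.
  by move=> hx hy; apply: le_trans (gK _ _ hx hy) _; rewrite ler_wpM2r // ler_norm.
have gC x : `|x| <= 3 -> `|g x| <= `|g 0| + `|K| * 3.
  move=> hx; have -> : g x = g 0 + (g x - g 0) by rewrite addrCA subrr addr0.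
  apply: le_trans (ler_normD _ _) _; rewrite lerD2l.
  by apply: le_trans (gK _ _ hx n3) _; rewrite ler_wpM2l // subr0.
have [D DP] := wlap_dquot Cxi xi0 gC.
have D0 : 0 <= D.
  by have := le_trans (normr_ge0 _) (DP 1%N isT); rewrite pmulr_lge0 // step_gt0.
set W := wlap g xi dxi in W0 DP.
pose f j x := xi x * (1 - dquot g j x).
have [C hC] := Cxi.
have C0 : 0 <= C by apply: jet_ge0 hC.
have dq j x : `|x| <= 2 -> `|dquot g j x| <= n%:R * `|K|.
  move=> hx; have t0 := step_gt0 R j; have hx3 : `|x| <= 3 by lra.
  apply: le_trans (ler_norm_sum _ _ _) _.
  apply: (@le_trans _ _ (\sum_(i < n) `|K|)); last by rewrite sumr_const card_ord mulr_natl.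
  apply: ler_sum => i _; rewrite normrM normfV [`|2 ^- j|]ger0_norm ?(ltW t0) //.
  rewrite ler_pdivrMr //.
  have -> : g (x + 2 ^- j *: evec R i) 0 i - g x 0 i = (g (x + 2 ^- j *: evec R i) - g x) 0 i.
    by rewrite !mxE.
  apply: le_trans (coord_le_norm _ _) _; apply: le_trans (gK _ _ (shift_le3 i j hx) hx3) _.
  rewrite ler_wpM2l // addrAC subrr add0r normrZ ger0_norm ?(ltW t0) //.
  by rewrite -[leRHS]mulr1 ler_wpM2l ?(ltW t0) // norm_evec.
have fb j x : `|x| <= 2 -> `|f j x| <= C * (1 + n%:R * `|K|).
  move=> hx; have hx3 : `|x| <= 3 by lra.
  rewrite normrM ler_pM //; first by have [] := hC x x hx3 hx3.
  by apply: le_trans (ler_normB _ _) _; rewrite normr1 lerD2l dq.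
have fcont j x : `|x| <= 2 -> {for x, continuous (f j.+1)}.
  move=> hx; have hx3 : `|x| < 3 by lra.
  have cxi : {for x, continuous xi}.
    apply: (lip_continuous hx3 (L := n%:R * C + 2 * 3 * C)).
      by rewrite addr_ge0 ?mulr_ge0.
    by move=> y hy; apply: (jet_lip _ hC) => //; exact: ltW.
  have cdq : {for x, continuous (dquot g j.+1)}.
    have t0 := step_gt0 R j.+1.
    (* Continuity at boundary points of the cube needs a neighbourhood: half side 5/2 plus a shift
       of at most 1/2, hence the index [j.+1], stays within 3. *)
    have hx52 : `|x| < 5 / 2 by lra.
    have sh (y : V) i : `|y| <= 5 / 2 -> `|y + 2 ^- j.+1 *: evec R i| <= 3.
      move=> hy; apply: le_trans (ler_normD _ _) _.
      rewrite (_ : 3 = 5 / 2 + 2^-1); last by lra.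
      rewrite lerD // normrZ -[leRHS]mulr1 ler_pM // ?norm_evec // ger0_norm ?(ltW t0) //.
      by rewrite lef_pV2 ?posrE ?exprn_gt0 // -{1}[2]expr1 ler_weXn2l // ler1n.
    apply: (lip_continuous hx52 (L := n%:R * (2 * `|K| / 2 ^- j.+1))).
      by rewrite !mulr_ge0 // invr_ge0 ltW.
    move=> y hy; rewrite /dquot -sumrB; apply: le_trans (ler_norm_sum _ _ _) _.
    apply: (@le_trans _ _ (\sum_(i < n) 2 * `|K| / 2 ^- j.+1 * `|y - x|)); last first.
      by rewrite sumr_const card_ord -[leLHS]mulr_natl [leLHS]mulrA.
    apply: ler_sum => i _; rewrite -mulrBl normrM normfV [`|2 ^- j.+1|]ger0_norm ?(ltW t0) //.
    rewrite mulrAC ler_pM2r ?invr_gt0 //.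
    have -> : g (y + 2 ^- j.+1 *: evec R i) 0 i - g y 0 i
         - (g (x + 2 ^- j.+1 *: evec R i) 0 i - g x 0 i) =
      (g (y + 2 ^- j.+1 *: evec R i) - g (x + 2 ^- j.+1 *: evec R i)) 0 i - (g y - g x) 0 i.
      by rewrite !mxE; ring.
    apply: le_trans (ler_normB _ _) _; rewrite -mulrA mulr_natl mulr2n.
    have hy3 : `|y| <= 3 by lra.
    have hx3' := ltW hx3.
    apply: lerD; (apply: le_trans (coord_le_norm _ _) _).
      apply: le_trans (gK _ _ (sh _ _ hy) (sh _ _ (ltW hx52))) _.
      by rewrite opprD addrACA subrr addr0.
    exact: gK.
  by have := cvgM cxi (cvgB (@cvg_cst _ (1 : R) _ _ _) cdq); apply.
have e4 : 0 < - W / 2 by lra.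
have [j0 _ j0P] : \forall j \near \oo, D * 2 ^- j <= - W / 2.
  have h : 0 < (- W / 2) / (D + 1) by rewrite divr_gt0 //; lra.
  apply: filterS (step_le h) => j hj.
  apply: le_trans (ler_wpM2l D0 hj) _.
  by rewrite mulrA ler_pdivrMr; nra.
(* Past [j0] the discretization error is at most -W/2, so the negative parts [h] have integrals at
   least -W/2. Off [N] the limit of [f] is [xi >= 0] where g = 0 and 0 elsewhere, so [h] tends to 0
   there, which [daniell] forbids. *)
pose h k x := Num.max (- f (j0 + k).+1 x) 0.
have bf j : bdd (f j) by exists (C * (1 + n%:R * `|K|)) => x; exact: fb.
apply: (@daniell _ _ h (C * (1 + n%:R * `|K|)) _ _ N (- W / 2)) => //.
- move=> k x hx; rewrite /h le_max lexx orbT /= ge_max; apply/andP; split.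
    by have := fb (j0 + k).+1 x hx; rewrite ler_norml; lra.
  by rewrite mulr_ge0 // addr_ge0 // mulr_ge0.
- move=> k x hx; have : {for x, continuous ((fun x => - f (j0 + k).+1 x) \max (fun=> 0))}.
    apply: continuous_max; last exact: cst_continuous.
    by have := cvgN (fcont (j0 + k)%N x hx); apply.
  exact.
- move=> x hx Nx d d0.
  have lim : f j x @[j --> \oo] --> xi x * (1 - (if g x != 0 then 1 else 0)).
    by have := cvgM (@cvg_cst _ (xi x) _ _ _) (cvgB (@cvg_cst _ (1 : R) _ _ _) (gN x hx Nx)); apply.
  have lim0 : - d < xi x * (1 - (if g x != 0 then 1 else 0)).
    apply: (@lt_le_trans _ _ 0); first by rewrite oppr_lt0.
    case: eqP => [g0|_] /=; last by rewrite subrr mulr0.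
    by rewrite subr0 mulr1 gxi.
  have [m _ mP] := cvgr_gt _ lim _ lim0.
  exists m => k mk; rewrite /h ge_max (ltW d0) andbT lerNl ltW //; apply: mP => /=.
  by rewrite (leq_trans mk) // (leq_trans (leq_addl j0 k)).
- move=> k; apply: (@le_trans _ _ (integ (fun x => - f (j0 + k).+1 x))); last first.
    apply: le_integ; first exact: bddN.
      apply: (@bdd_range _ _ _ 0 (C * (1 + n%:R * `|K|))) => x hx.
      rewrite /h le_max lexx orbT /= ge_max; apply/andP; split.
        by have := fb (j0 + k).+1 x hx; rewrite ler_norml; lra.
      by rewrite mulr_ge0 // addr_ge0 // mulr_ge0.
    by move=> x _; rewrite /h le_max lexx.
  under eq_fun do rewrite -mulN1r.
  rewrite integZ // mulN1r.
  have := DP (j0 + k).+1 isT; have := j0P (j0 + k).+1; rewrite /= -/(f _).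
  rewrite leqW ?leq_addr // => /(_ isT) h1 h2.
  by have := le_trans h2 h1; rewrite ler_norml => /andP[_]; lra.
Qed.

(** The difference quotients of a linear gradient equal the trace exactly, so the discretized
    integrand is 0 and [wlap] is smaller than every D 2^-j. *)
Lemma wlap_quad (A : 'M[R]_n) xi dxi : \tr A = 1 -> C11 3 xi dxi ->
  (forall x i, 1 <= `|x 0 i| -> xi x = 0) -> wlap (fun x => x *m A) xi dxi = 0.
Proof.
move=> A1 Cxi xi0.
have dq j x : dquot (fun x => x *m A) j x = 1.
  rewrite -A1; apply: eq_bigr => i _; rewrite mulmxDl -scalemxAl !mxE addrAC subrr add0r.
  rewrite mulrAC mulfV ?mul1r ?gt_eqF ?step_gt0 //.
  rewrite (bigD1 i) //= big1 ?addr0 ?evec_coord ?eqxx ?mul1r // => k ki.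
  by rewrite evec_coord (negbTE ki) mul0r.
have AC (x : V) : `|x| <= 3 -> `|x *m A| <= n%:R * (3 * `|A|).
  by move=> hx; apply: le_trans (norm_mulmx x A) _; rewrite ler_wpM2l // ler_wpM2r.
have [D DP] := wlap_dquot Cxi xi0 AC.
have {}DP j : (0 < j)%N -> `|wlap (fun x => x *m A) xi dxi| <= D * 2 ^- j.
  move=> /DP; rewrite (@eq_integ _ _ _ (fun=> 0)) => [|x _]; last by rewrite dq subrr mulr0.
  by rewrite integ_cst mul0r sub0r normrN.
apply/eqP; rewrite -normr_le0; apply/ler_addgt0Pr => e e0; rewrite add0r.
have D0 : 0 <= D.
  by have := le_trans (normr_ge0 _) (DP 1%N isT); rewrite pmulr_lge0 // step_gt0.
have h : 0 < e / (D + 1) by rewrite divr_gt0 //; lra.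
have [j _ jP] := step_le h.
apply: le_trans (DP j.+1 isT) _; apply: le_trans (ler_wpM2l D0 (jP j.+1 _)) _ => //=.
by rewrite mulrA ler_pdivrMr; nra.
Qed.

End WeakLaplacian.

(** * Weiss energy and Monneau functional *)

Section Weights.
Variables (R : realType) (n : nat).
Notation V := 'rV[R]_n.
Implicit Types (x y : V).

(* The gradient of [cutoff] is [- wt x *: x]; this link between the two weights is what
   makes the boundary terms of the Weiss and Monneau formulas cancel. *)
Definition gap x : R := Num.max 0 (1 - dot x x).
Definition cutoff x : R := gap x ^+ 3.
Definition wt x : R := 6 * gap x ^+ 2.

Lemma gap_bound x : 0 <= gap x <= 1.
Proof.
rewrite /gap le_max lexx /= ge_max ler01 /=.
by have := dot_ge0 x; lra.
Qed.

Lemma cutoff_bound x : 0 <= cutoff x <= 1.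
Proof. by have /andP[h1 h2] := gap_bound x; rewrite exprn_ge0 ?exprn_ile1. Qed.

Lemma wt_bound x : 0 <= wt x <= 6.
Proof.
have /andP[h1 h2] := gap_bound x.
have := exprn_ge0 2 h1; have := exprn_ile1 2 h1 h2; rewrite /wt; lra.
Qed.

Lemma gap_supp x i : 1 <= `|x 0 i| -> gap x = 0.
Proof.
move=> hx; rewrite /gap max_l // subr_le0 /dot (bigD1 i) //=.
have : 0 <= \sum_(j < n | j != i) x 0 j * x 0 j.
  by apply: sumr_ge0 => j _; rewrite -expr2 sqr_ge0.
have : 1 <= x 0 i * x 0 i by rewrite -expr2 -real_normK ?num_real // exprn_ege1.
lra.
Qed.

Lemma cutoff_supp x i : 1 <= `|x 0 i| -> cutoff x = 0.
Proof. by move=> /gap_supp; rewrite /cutoff => ->; rewrite expr0n. Qed.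

Lemma cube_pos_taylor (s t : R) : s <= 1 -> t <= 1 ->
  `|Num.max 0 t ^+ 3 - Num.max 0 s ^+ 3 - 3 * Num.max 0 s ^+ 2 * (t - s)|
    <= 5 * (t - s) ^+ 2.
Proof.
move=> s1 t1; have [s0|s0] := leP s 0; have [t0|t0] := leP t 0.
- by rewrite !expr0n /= !(mulr0, mul0r, subr0) normr0 mulr_ge0 // sqr_ge0.
- rewrite !expr0n /= !(mulr0, mul0r, subr0) ger0_norm ?exprn_ge0 ?(ltW t0) //.
  by nra.
- have a1 : 0 <= s ^+ 2 * (1 - s) by rewrite mulr_ge0 ?sqr_ge0 //; lra.
  have a2 : 0 <= s * (- t) by rewrite mulr_ge0 //; lra.
  have a3 : 0 <= s * (- t) * (1 - s) by rewrite mulr_ge0 //; lra.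
  have a4 : 0 <= s ^+ 2 * (- t) by rewrite mulr_ge0 ?sqr_ge0 //; lra.
  have a5 : 0 <= s ^+ 3 by rewrite exprn_ge0 // ltW.
  have a6 := sqr_ge0 t; have a7 := sqr_ge0 s.
  have -> : 0 ^+ 3 - s ^+ 3 - 3 * s ^+ 2 * (t - s) = 2 * s ^+ 3 + 3 * (s ^+ 2 * - t) by ring.
  rewrite ger0_norm; last by rewrite addr_ge0 // mulr_ge0.
  have -> : (t - s) ^+ 2 = t ^+ 2 + s ^+ 2 + 2 * (s * - t) by ring.
  have : s ^+ 2 * (1 - s) = s ^+ 2 - s ^+ 3 by ring.
  have : s * - t * (1 - s) = s * - t - s ^+ 2 * - t by ring.
  lra.
- have -> : t ^+ 3 - s ^+ 3 - 3 * s ^+ 2 * (t - s) = (t + 2 * s) * (t - s) ^+ 2 by ring.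
  have p0 : 0 <= t + 2 * s by lra.
  have p5 : t + 2 * s <= 5 by lra.
  rewrite ger0_norm; last by rewrite mulr_ge0 ?sqr_ge0.
  by rewrite ler_wpM2r ?sqr_ge0.
Qed.

Lemma C11_cutoff (c : R) : 0 <= c -> C11 c cutoff (fun x => - wt x *: x).
Proof.
move=> c0; exists (5 * (4 * n%:R * c) ^+ 2 + 3 * n%:R + 1 + 6 * c) => x y hx hy.
have p1 : 0 <= 5 * (4 * n%:R * c) ^+ 2 by rewrite mulr_ge0 // sqr_ge0.
have p2 : 0 <= 3 * n%:R :> R by rewrite mulr_ge0.
have /andP[e0 e1] := cutoff_bound x; have /andP[w0 w1] := wt_bound x; split.
- by rewrite ger0_norm //; lra.
- rewrite normrZ normrN ger0_norm //.
  suff : wt x * `|x| <= 6 * c by lra.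
  by rewrite ler_pM.
set h := y - x; have yE : y = x + h by rewrite /h addrCA subrr addr0.
have dh : `|dot h h| <= n%:R * `|h| ^+ 2 by exact: norm_dot.
have st : (1 - dot y y) - (1 - dot x x) = - 2 * dot x h - dot h h.
  by rewrite [in LHS]yE dotDl (dotDr x h x) (dotDr x h h) (dotC h x); ring.
have h2 : `|h| <= 2 * c.
  by apply: le_trans (ler_normB _ _) _; rewrite mulr_natl mulr2n lerD.
have st2 : ((1 - dot y y) - (1 - dot x x)) ^+ 2 <= (4 * n%:R * c) ^+ 2 * `|h| ^+ 2.
  rewrite -exprMn -[leLHS]real_normK ?num_real //.
  rewrite lerXn2r ?nnegrE ?mulr_ge0 // st.
  apply: le_trans (ler_normB _ _) _.
  rewrite normrM normrN (ger0_norm (ler0n _ 2)).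
  have a1 : `|dot x h| <= n%:R * (c * `|h|).
    by apply: le_trans (norm_dot _ _) _; rewrite ler_wpM2l // ler_wpM2r.
  have a2 : n%:R * `|h| ^+ 2 <= n%:R * (2 * c * `|h|).
    by rewrite ler_wpM2l // expr2 ler_wpM2r.
  lra.
have sle (z : V) : 1 - dot z z <= 1 by have := dot_ge0 z; lra.
have T := cube_pos_taylor (sle x) (sle y).
rewrite -/(gap x) -/(gap y) -/(cutoff x) -/(cutoff y) in T.
have -> : cutoff y - cutoff x - dot (- wt x *: x) h =
   (cutoff y - cutoff x - 3 * gap x ^+ 2 * ((1 - dot y y) - (1 - dot x x)))
   - 3 * gap x ^+ 2 * dot h h.
  by rewrite st dotZl /wt; ring.
apply: le_trans (ler_normB _ _) _.
have b2 : `|3 * gap x ^+ 2 * dot h h| <= 3 * n%:R * `|h| ^+ 2.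
  rewrite normrM -[leRHS]mulrA; apply: ler_pM => //.
  have /andP[g0 g1] := gap_bound x; have := exprn_ile1 2 g0 g1; have := sqr_ge0 (gap x).
  by move=> h0 h1; rewrite ger0_norm; lra.
have b3 : 0 <= (1 + 6 * c) * `|h| ^+ 2 by rewrite mulr_ge0 ?sqr_ge0 //; lra.
lra.
Qed.

Lemma bdd_cutoff : bdd cutoff.
Proof. by apply: (@bdd_range _ _ _ 0 1) => x _; exact: cutoff_bound. Qed.

Lemma bdd_wt : bdd wt.
Proof. by apply: (@bdd_range _ _ _ 0 6) => x _; exact: wt_bound. Qed.

Lemma bddvD (g1 g2 : V -> V) : bddv g1 -> bddv g2 -> bddv (fun x => g1 x + g2 x).
Proof.
by move=> h1 h2 i; under eq_fun do rewrite mxE; exact: (bddD (h1 i) (h2 i)).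
Qed.

Lemma bddvZ (f : V -> R) (g : V -> V) : bdd f -> bddv g -> bddv (fun x => f x *: g x).
Proof.
by move=> h1 h2 i; under eq_fun do rewrite mxE; exact: (bddM h1 (h2 i)).
Qed.

Lemma bddvN (g : V -> V) : bddv g -> bddv (fun x => - g x).
Proof. by move=> h i; under eq_fun do rewrite mxE; exact: (bddN (h i)). Qed.

Lemma bddv_id : bddv (fun x : V => x).
Proof. exact: bdd_coord. Qed.

Lemma C11_bddv (f : V -> R) (g : V -> V) : C11 3 f g -> bddv g.
Proof. by move=> h i; apply: C11_bddg h; rewrite ler_nat. Qed.

Lemma C11_bdd3 f (g : V -> V) : C11 3 f g -> bdd f.
Proof. by apply: C11_bdd; rewrite ler_nat. Qed.

End Weights.

Ltac bddt := repeat first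
  [ assumption | apply: bdd_cutoff | apply: bdd_wt | apply: bddv_id
  | lazymatch goal with
    | |- bdd (fun x => dot (@?f x) (@?g x)) => apply: (@bdd_dot _ _ f g)
    | |- bddv (fun x => @?f x + @?g x) => apply: (@bddvD _ _ f g)
    | |- bddv (fun x => - @?f x) => apply: (@bddvN _ _ f)
    | |- bddv (fun x => @?f x *: @?g x) => apply: (@bddvZ _ _ f g)
    end
  | bdd1 ].

(** * Expansion of the Weiss energy and the Monneau identity *)

Section Energy.
Variables (R : realType) (n : nat).
Notation V := 'rV[R]_n.
Implicit Types (x y : V) (v z q : V -> R) (g dz dq : V -> V).

Definition wlape g z dz : R :=
  wlap g (fun x => z x * cutoff x) (fun x => z x *: (- wt x *: x) + cutoff x *: dz x).

Definition energy v g : R :=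
  integ (fun x => cutoff x * dot (g x) (g x) + 2 * (v x * cutoff x) - 2 * (v x ^+ 2 * wt x)).

(** The derivative of [dil lam v] at lam = 1 when [g] is the gradient of [v]; it vanishes on
    functions homogeneous of degree 2. *)
Definition euler v g x : R := dot x (g x) - 2 * v x.

Lemma wlapeE g z dz : wlape g z dz =
  integ (fun x => z x * cutoff x + cutoff x * dot (g x) (dz x) - wt x * z x * dot x (g x)).
Proof.
apply: eq_integ => x _; rewrite dotDr !dotZr (dotC (g x) x); ring.
Qed.

Lemma wlapeD g z1 dz1 z2 dz2 : bddv g -> C11 3 z1 dz1 -> C11 3 z2 dz2 ->
  wlape g (fun x => z1 x + z2 x) (fun x => dz1 x + dz2 x) = wlape g z1 dz1 + wlape g z2 dz2.
Proof.
move=> bg h1 h2; have ? := C11_bdd3 h1; have ? := C11_bdd3 h2.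
have ? := C11_bddv h1; have ? := C11_bddv h2.
rewrite !wlapeE -integD; [|by bddt|by bddt].
by apply: eq_integ => x _; rewrite dotDr; ring.
Qed.

Lemma wlapeZ g (c : R) z dz : bddv g -> C11 3 z dz ->
  wlape g (fun x => c * z x) (fun x => c *: dz x) = c * wlape g z dz.
Proof.
move=> bg h1; have ? := C11_bdd3 h1; have ? := C11_bddv h1.
rewrite !wlapeE -integZ; last by bddt.
by apply: eq_integ => x _; rewrite dotZr; ring.
Qed.

(** An exact expansion. The cutoff gradient - b x inside [wlape] contributes b z (x . g), which
    joins the cross term of - 2 v^2 b to form the Euler operator. *)
Lemma energyD v g z dz : C11 3 v g -> C11 3 z dz ->
  energy (fun x => v x + z x) (fun x => g x + dz x) =
  energy v g + 2 * wlape g z dz + 2 * integ (fun x => wt x * (z x * euler v g x))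
  + integ (fun x => cutoff x * dot (dz x) (dz x)) - 2 * integ (fun x => z x ^+ 2 * wt x).
Proof.
move=> h1 h2; have ? := C11_bdd3 h1; have ? := C11_bdd3 h2.
have ? := C11_bddv h1; have ? := C11_bddv h2.
rewrite wlapeE /energy /euler.
rewrite -!integZ; [|by bddt..].
rewrite -!integD; [|by bddt..].
rewrite -integB; [|by bddt..].
apply: eq_integ => x _; rewrite !dotDl !dotDr (dotC (dz x) (g x)); ring.
Qed.

Lemma C11_wlape z dz : C11 3 z dz ->
  C11 3 (fun x => z x * cutoff x) (fun x => z x *: (- wt x *: x) + cutoff x *: dz x).
Proof. by move=> h; apply: C11M => //; exact: C11_cutoff. Qed.

Definition qgrad (A : 'M[R]_n) (x : V) : V := x *m A.

Lemma quadpE (A : 'M[R]_n) x : quadp A x = 2^-1 * dot x (qgrad A x).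
Proof.
rewrite /quadp; congr (_ * _); rewrite mxE; apply: eq_bigr => i _.
by rewrite mulrC [x^T _ _]mxE.
Qed.

Lemma dot_qgradC (A : 'M[R]_n) x y : A^T = A -> dot x (qgrad A y) = dot y (qgrad A x).
Proof.
move=> sA; have dE (z1 z2 : V) : dot z1 (qgrad A z2) = (z1 *m (z2 *m A)^T) 0 0.
  by rewrite mxE; apply: eq_bigr => i _; rewrite [_^T _ _]mxE.
rewrite !dE trmx_mul sA mulmxA.
have -> : (x *m A *m y^T) 0 0 = (x *m A *m y^T)^T 0 0 by rewrite [RHS]mxE.
by rewrite !trmx_mul trmxK sA mulmxA.
Qed.

Lemma quadp_bound (A : 'M[R]_n) x : `|quadp A x| <= n%:R ^+ 2 * `|A| * `|x| ^+ 2.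
Proof.
rewrite quadpE normrM ger0_norm ?invr_ge0 //.
have h : `|dot x (qgrad A x)| <= n%:R ^+ 2 * `|A| * `|x| ^+ 2.
  apply: le_trans (norm_dot _ _) _.
  have -> : n%:R ^+ 2 * `|A| * `|x| ^+ 2 = n%:R * (`|x| * (n%:R * (`|x| * `|A|))) by ring.
  by rewrite !ler_wpM2l // norm_mulmx.
have : 0 <= n%:R ^+ 2 * `|A| * `|x| ^+ 2 by rewrite !mulr_ge0 ?sqr_ge0.
by have := normr_ge0 (dot x (qgrad A x)); lra.
Qed.

Lemma quadpZ (B : 'M[R]_n) (c : R) x : quadp B (c *: x) = c ^+ 2 * quadp B x.
Proof. by rewrite !quadpE /qgrad -scalemxAl dotZl dotZr; ring. Qed.

Lemma quadp_taylor (B : 'M[R]_n) x y : B^T = B ->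
  `|quadp B y - quadp B x - dot (qgrad B x) (y - x)| <= n%:R ^+ 2 * `|B| * `|y - x| ^+ 2.
Proof.
move=> sB; have [h ->] : exists h, y = x + h by exists (y - x); rewrite addrCA subrr addr0.
have -> : x + h - x = h by rewrite addrC addKr.
suff -> : quadp B (x + h) - quadp B x - dot (qgrad B x) h = quadp B h by exact: quadp_bound.
rewrite !quadpE; have -> : qgrad B (x + h) = qgrad B x + qgrad B h by rewrite /qgrad mulmxDl.
by rewrite !dotDl !dotDr (dot_qgradC x h sB) (dotC (qgrad B x) h); field.
Qed.

Lemma C11_quadp (A : 'M[R]_n) (c : R) : A^T = A -> 0 <= c -> C11 c (quadp A) (qgrad A).
Proof.
move=> sA c0; pose B := n%:R ^+ 2 * `|A|; pose D := n%:R * `|A|.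
have B0 : 0 <= B by rewrite mulr_ge0 ?sqr_ge0.
have D0 : 0 <= D by rewrite mulr_ge0.
exists (B * c ^+ 2 + D * c + B) => x y hx hy.
have p1 : 0 <= B * c ^+ 2 by rewrite mulr_ge0 ?sqr_ge0.
have p2 : 0 <= D * c by rewrite mulr_ge0.
split.
- apply: le_trans (quadp_bound A x) _; rewrite -/B.
  suff : B * `|x| ^+ 2 <= B * c ^+ 2 by lra.
  by rewrite ler_wpM2l // lerXn2r ?nnegrE.
- apply: le_trans (norm_mulmx x A) _.
  suff : n%:R * (`|x| * `|A|) <= D * c by lra.
  by rewrite -mulrA [`|A| * c]mulrC ler_wpM2l // ler_wpM2r.
- apply: le_trans (quadp_taylor x y sA) _.
  by rewrite -/B ler_wpM2r ?sqr_ge0 //; lra.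
Qed.

Lemma euler_quadp (A : 'M[R]_n) x : euler (quadp A) (qgrad A) x = 0.
Proof. by rewrite /euler quadpE; field. Qed.

Lemma wlape_quad (A : 'M[R]_n) z dz : \tr A = 1 -> C11 3 z dz ->
  wlape (qgrad A) z dz = 0.
Proof.
move=> A1 hz; apply: wlap_quad => //; first exact: C11_wlape.
by move=> x i /cutoff_supp ->; rewrite mulr0.
Qed.

(** Expanding the energy about q, where [wlape] and the Euler operator vanish, leaves int eta |grad
    w|^2 - 2 int b w^2 with w = v - q. Subtracting the zero quantity [wlape (qgrad A)] from
    [wlape g] trades the Dirichlet term for int b w (x . grad w), and Zw = Zv because Zq = 0. *)
Lemma monneau_identity v g (A : 'M[R]_n) : A^T = A -> \tr A = 1 -> C11 3 v g ->
  integ (fun x => wt x * ((v x - quadp A x) * euler v g x)) =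
  energy v g - energy (quadp A) (qgrad A)
  - wlape g (fun x => v x - quadp A x) (fun x => g x - qgrad A x).
Proof.
move=> sA A1 hv; have hq := C11_quadp sA (ler0n R 3).
have hw : C11 3 (fun x => v x - quadp A x) (fun x => g x - qgrad A x).
  have := C11D hv (C11Z (-1) hq).
  by congr (C11 3 _ _); apply/funext => x; rewrite ?mulN1r ?scaleN1r.
have E : energy v g = energy (fun x => quadp A x + (v x - quadp A x))
                             (fun x => qgrad A x + (g x - qgrad A x)).
  congr energy; apply/funext => x; by rewrite addrCA subrr addr0.
have W0 := wlape_quad A1 hw.
have ? := C11_bdd3 hv; have ? := C11_bddv hv; have ? := C11_bdd3 hq; have ? := C11_bddv hq.
have D : wlape g (fun x => v x - quadp A x) (fun x => g x - qgrad A x) =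
    integ (fun x => cutoff x * dot (g x - qgrad A x) (g x - qgrad A x)) -
    integ (fun x => wt x * (v x - quadp A x) * dot x (g x - qgrad A x)).
  rewrite -[LHS]subr0 -W0 !wlapeE.
  rewrite -!integB; [|by bddt..].
  by apply: eq_integ => x _; rewrite !dotDl !dotDr !dotNr !dotNl; ring.
have I0 : integ (fun x => wt x * ((v x - quadp A x) * euler (quadp A) (qgrad A) x)) = 0.
  rewrite -[RHS](mul0r (4 ^+ n)) -integ_cst; apply: eq_integ => x _.
  by rewrite euler_quadp !mulr0.
have -> : integ (fun x => wt x * ((v x - quadp A x) * euler v g x)) =
    integ (fun x => wt x * (v x - quadp A x) * dot x (g x - qgrad A x)) -
    2 * integ (fun x => (v x - quadp A x) ^+ 2 * wt x).
  rewrite -integZ; last by bddt.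
  rewrite -integB; [|by bddt..].
  apply: eq_integ => x _; have := euler_quadp A x; rewrite /euler dotDr dotNr => /eqP.
  by rewrite subr_eq0 => /eqP ->; ring.
rewrite E (energyD hq hw) W0 D I0; ring.
Qed.

(** [monneau_identity] with v itself in Q: the left side is 0 by homogeneity, and the [wlape] term
    is 0 because Delta v = 1 everywhere. *)
Lemma energy_quad (A B : 'M[R]_n) : A^T = A -> \tr A = 1 -> B^T = B -> \tr B = 1 ->
  energy (quadp A) (qgrad A) = energy (quadp B) (qgrad B).
Proof.
move=> sA A1 sB B1; have hA := C11_quadp sA (ler0n R 3); have hB := C11_quadp sB (ler0n R 3).
have := monneau_identity sB B1 hA.
rewrite wlape_quad //; last first.
  have := C11D hA (C11Z (-1) hB).
  by congr (C11 3 _ _); apply/funext => x; rewrite ?mulN1r ?scaleN1r.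
rewrite (@eq_integ _ _ _ (fun=> 0)) => [|x _]; last by rewrite euler_quadp !mulr0.
by rewrite integ_cst mul0r subr0 => /eqP; rewrite eq_sym subr_eq0 => /eqP.
Qed.

End Energy.

(** * Change of the energy and of the Monneau functional under a small dilation *)

Section Steps.
Variables (R : realType) (n : nat).
Notation V := 'rV[R]_n.
Implicit Types (x y : V) (v z q : V -> R) (g dz dq : V -> V).

(** What the one-step estimates use of a rescaled solution, with one constant [K] for all scales.
    The radius 6 allows a dilation by up to 2 before restricting to radius 3; the equation appears
    as convergence of difference quotients off a null set. *)
Record sol (K : R) v g : Prop := Sol {
  sol_jet : jet 6 K v g;
  sol_lip : forall x y, `|x| <= 6 -> `|y| <= 6 -> `|g x - g y| <= K * `|x - y|;
  sol_ae : exists2 N, Defs.null_set N & forall x, `|x| <= 2 -> ~ N x ->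
     dquot g j x @[j --> \oo] --> (if g x != 0 then 1 else 0 : R);
  sol_npos : forall x, `|x| <= 2 -> g x = 0 -> v x <= 0 }.

Lemma sol_C11 K v g : sol K v g -> C11 3 v g.
Proof.
move=> [h _ _ _]; exists K => x y hx hy; apply: h.
  by apply: le_trans hx _; rewrite ler_nat.
by apply: le_trans hy _; rewrite ler_nat.
Qed.

Lemma sol_wlape_ge0 K v g z dz : sol K v g -> C11 3 z dz ->
  (forall x, `|x| <= 2 -> g x = 0 -> 0 <= z x) -> 0 <= wlape g z dz.
Proof.
move=> [_ gl [N N0 gN] _] hz z0.
apply: (@wlap_ge0 _ _ g K N) => //.
- exact: C11_wlape.
- by move=> x i /cutoff_supp ->; rewrite mulr0.
- move=> x y hx hy; apply: gl.
    by apply: le_trans hx _; rewrite ler_nat.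
  by apply: le_trans hy _; rewrite ler_nat.
- move=> x hx gx; rewrite mulr_ge0 ?z0 //; by case/andP: (cutoff_bound x).
Qed.

Definition dil (lam : R) v x : R := v (lam *: x) / lam ^+ 2.
Definition dilg (lam : R) g x : V := lam^-1 *: g (lam *: x).

Lemma C11_dil K v g lam : jet 6 K v g -> 1 <= lam <= 2 -> C11 3 (dil lam v) (dilg lam g).
Proof.
move=> h /andP[l1 l2]; have l0 : 0 < lam by lra.
have K0 : 0 <= K by apply: jet_ge0 h.
have il : lam^-1 <= 1 by rewrite invf_le1.
have il2 : (lam ^+ 2)^-1 <= 1 by rewrite invf_le1 ?exprn_gt0 // exprn_ege1.
have i0 : 0 <= lam^-1 by rewrite invr_ge0 ltW.
have i20 : 0 <= (lam ^+ 2)^-1 by rewrite invr_ge0 exprn_ge0 // ltW.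
have s6 x : `|x| <= 3 -> `|lam *: x| <= 6.
  move=> hx; rewrite normrZ ger0_norm ?(ltW l0) //.
  by have := ler_pM (ltW l0) (normr_ge0 x) l2 hx; lra.
exists K => x y /s6 hx /s6 hy; have [a b c] := h _ _ hx hy; split.
- by rewrite normrM (ger0_norm i20) -[leRHS]mulr1 ler_pM.
- by rewrite normrZ (ger0_norm i0) -[leRHS]mul1r ler_pM.
- move: c; rewrite -scalerBr dotZr normrZ ger0_norm ?(ltW l0) // exprMn => c.
  have -> : dil lam v y - dil lam v x - dot (dilg lam g x) (y - x) =
     (lam ^+ 2)^-1 * (v (lam *: y) - v (lam *: x) - lam * dot (g (lam *: x)) (y - x)).
    by rewrite /dil /dilg dotZl; field; rewrite gt_eqF.
  rewrite normrM (ger0_norm i20) mulrC ler_pdivrMr ?exprn_gt0 //.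
  by apply: le_trans c _; rewrite mulrCA mulrC.
Qed.

Lemma euler_bound K v g x : jet 6 K v g -> `|x| <= 2 ->
  `|euler v g x| <= (2 * n%:R + 2) * K.
Proof.
move=> h hx; have hx6 : `|x| <= 6 by lra.
have [a b _] := h x x hx6 hx6.
have K0 : 0 <= K by apply: le_trans a.
apply: le_trans (ler_normB _ _) _; rewrite [leRHS]mulrDl lerD //.
  apply: le_trans (norm_dot _ _) _; rewrite [2 * _]mulrC -mulrA ler_wpM2l //.
  by rewrite ler_pM.
by rewrite normrM ger0_norm // ler_wpM2l.
Qed.

(** The constant is 4 + 5 + 4 n: the Taylor remainder over the displacement e x with |x| <= 2, the
    second-order part of (1 + e)^-2 multiplying v, and its first-order part multiplying e x . g. *)
Lemma dil_expand K v g x e : jet 6 K v g -> 0 < e <= 1 -> `|x| <= 2 ->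
  `|dil (1 + e) v x - v x - e * euler v g x| <= (9 + 4 * n%:R) * K * e ^+ 2.
Proof.
move=> h /andP[e0 e1] hx; have hx6 : `|x| <= 6 by lra.
have hx6' : `|(1 + e) *: x| <= 6.
  rewrite normrZ ger0_norm; last by lra.
  have : (1 + e) * `|x| <= 2 * 2 by apply: ler_pM => //; lra.
  lra.
have [vK gK vT] := h _ _ hx6 hx6'.
have K0 : 0 <= K by apply: le_trans vK.
have hE : (1 + e) *: x - x = e *: x by rewrite scalerDl scale1r addrAC subrr add0r.
move: vT; rewrite hE dotZr dotC normrZ (ger0_norm (ltW e0)).
set P := _ - _ - _ => hP.
have {}hP : `|P| <= 4 * K * e ^+ 2.
  apply: le_trans hP _; rewrite exprMn.
  have -> : 4 * K * e ^+ 2 = K * (e ^+ 2 * 2 ^+ 2) by ring.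
  by rewrite ler_wpM2l // ler_wpM2l ?sqr_ge0 // lerXn2r ?nnegrE.
have hd : `|dot x (g x)| <= 2 * n%:R * K.
  apply: le_trans (norm_dot _ _) _; rewrite [2 * _]mulrC -mulrA ler_wpM2l //.
  by rewrite ler_pM.
pose a := ((1 + e) ^+ 2)^-1.
have p2 : 0 < (1 + e) ^+ 2 by rewrite exprn_gt0 //; lra.
have a0 : 0 <= a by rewrite invr_ge0 ltW.
have a1 : a <= 1 by rewrite invf_le1 // exprn_ege1 //; lra.
have aE : a * (1 + e) ^+ 2 = 1 by rewrite mulVf // gt_eqF.
have ec : 0 <= e ^+ 2 by exact: sqr_ge0.
have -> : dil (1 + e) v x - v x - e * euler v g x =
   a * P + v x * (a * (3 * e ^+ 2 + 2 * e ^+ 3)) - e * dot x (g x) * (a * (2 * e + e ^+ 2)).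
  rewrite /dil /euler /P -/a.
  have -> : a * (3 * e ^+ 2 + 2 * e ^+ 3) = a - 1 + 2 * e.
    have -> : a - 1 + 2 * e = a - (a * (1 + e) ^+ 2) * (1 - 2 * e) by rewrite aE; ring.
    by ring.
  have -> : a * (2 * e + e ^+ 2) = 1 - a by rewrite -{2}aE; ring.
  by ring.
have e3 : e ^+ 3 <= e ^+ 2 by rewrite ler_wiXn2l // ltW.
have e30 : 0 <= e ^+ 3 by rewrite exprn_ge0 // ltW.
have b1 : `|a * P| <= 4 * K * e ^+ 2.
  by rewrite normrM (ger0_norm a0) -[leRHS]mul1r ler_pM.
have b2 : `|v x * (a * (3 * e ^+ 2 + 2 * e ^+ 3))| <= K * (5 * e ^+ 2).
  rewrite normrM ler_pM // ger0_norm; last by rewrite mulr_ge0 // addr_ge0 // mulr_ge0.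
  rewrite -[leRHS]mul1r ler_pM //; last by lra.
  by rewrite addr_ge0 // mulr_ge0.
have b3 : `|e * dot x (g x) * (a * (2 * e + e ^+ 2))| <= e * (2 * n%:R * K) * (2 * e).
  rewrite normrM ler_pM //; first by rewrite normrM (ger0_norm (ltW e0)) ler_wpM2l // ltW.
  have q0 : 0 <= 2 * e + e ^+ 2 by lra.
  rewrite ger0_norm; last by rewrite mulr_ge0.
  have : a * (2 * e + e ^+ 2) <= a * (2 * e * (1 + e) ^+ 2).
    rewrite ler_wpM2l //.
    have -> : 2 * e * (1 + e) ^+ 2 = 2 * e + 4 * e ^+ 2 + 2 * e ^+ 3 by ring.
    lra.
  by rewrite mulrCA aE mulr1.
apply: le_trans (ler_normB _ _) _.
apply: le_trans (lerD (ler_normD _ _) (lexx _)) _.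
have : e * (2 * n%:R * K) * (2 * e) = 4 * n%:R * K * e ^+ 2 by ring.
have : (9 + 4 * n%:R) * K * e ^+ 2 = 4 * K * e ^+ 2 + K * (5 * e ^+ 2) + 4 * n%:R * K * e ^+ 2.
  by ring.
lra.
Qed.

Lemma C11_cst (c : R) : C11 3 (fun _ : V => c) (fun=> 0).
Proof.
exists `|c| => x y _ _; split=> //; first by rewrite normr0.
by rewrite subrr sub0r dotC -(scale0r x) dotZr mul0r oppr0 normr0 mulr_ge0 ?sqr_ge0.
Qed.

Lemma C11B (f1 f2 : V -> R) (g1 g2 : V -> V) : C11 3 f1 g1 -> C11 3 f2 g2 ->
  C11 3 (fun x => f1 x - f2 x) (fun x => g1 x - g2 x).
Proof.
move=> h1 h2; have := C11D h1 (C11Z (-1) h2).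
by congr (C11 3 _ _); apply/funext => x; rewrite ?mulN1r ?scaleN1r.
Qed.

Lemma integ_ge_cst (f : V -> R) (c : R) : bdd f ->
  (forall x, `|x| <= 2 -> c <= f x) -> c * 4 ^+ n <= integ f.
Proof. by move=> bf h; rewrite -integ_cst; apply: le_integ => //; exact: bdd_cst. Qed.

(** Total mass of the positive functional [wlape g]: a uniform error in a test function costs at
    most that error times this mass. *)
Lemma wlape_cst_bound K v g : sol K v g ->
  wlape g (fun=> 1) (fun=> 0) <= (1 + 12 * n%:R * K) * 4 ^+ n.
Proof.
move=> hs; have hv := sol_C11 hs; have ? := C11_bddv hv.
rewrite wlapeE; apply: le_trans (ler_norm _) _; apply: norm_integ_le => x hx.
have hx6 : `|x| <= 6 by lra.
have [a b _] := sol_jet hs hx6 hx6.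
have /andP[e0 e1] := cutoff_bound x; have /andP[w0 w1] := wt_bound x.
rewrite mul1r mulr1 (_ : dot (g x) 0 = 0) ?mulr0 ?addr0; last first.
  by rewrite -(scale0r x) dotZr mul0r.
apply: le_trans (ler_normB _ _) _; rewrite (ger0_norm e0) lerD // normrM (ger0_norm w0).
have hd : `|dot x (g x)| <= n%:R * (2 * K).
  by apply: le_trans (norm_dot _ _) _; rewrite ler_wpM2l // ler_pM.
by have := ler_pM w0 (normr_ge0 _) w1 hd; lra.
Qed.

(** Take for z the increment in [energyD]: [wlape g z] is nonnegative up to O(e^2), b z Zv equals e
    b (Zv)^2 up to O(e^2), the Dirichlet term of z has the good sign, and z^2 is O(e^2). The
    constant depends on K and n only, hence not on the scale. *)
Lemma energy_step (K : R) : 0 <= K -> exists2 C, 0 <= C & forall v g e,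
  sol K v g -> 0 < e <= 1 ->
  energy v g - C * e ^+ 2 <= energy (dil (1 + e) v) (dilg (1 + e) g).
Proof.
move=> K0; pose C1 := (9 + 4 * n%:R) * K; pose C2 := (2 * n%:R + 2) * K.
have n0 : 0 <= n%:R :> R by [].
have C10 : 0 <= C1 by rewrite mulr_ge0 // addr_ge0 // mulr_ge0.
have C20 : 0 <= C2 by rewrite mulr_ge0 // addr_ge0 // mulr_ge0.
pose W := (1 + 12 * n%:R * K) * 4 ^+ n.
have c4 : 0 < 4 ^+ n :> R by rewrite exprn_gt0.
have W0 : 0 <= W by rewrite mulr_ge0 ?(ltW c4) // addr_ge0 // !mulr_ge0.
have p1 : 0 <= C1 * W by rewrite mulr_ge0.
have p2 : 0 <= C1 * C2 * 4 ^+ n by rewrite !mulr_ge0 // ltW.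
have p3 : 0 <= (C1 + C2) ^+ 2 * 4 ^+ n by rewrite mulr_ge0 ?sqr_ge0 // ltW.
exists (2 * (C1 * W) + 12 * (C1 * C2 * 4 ^+ n) + 12 * ((C1 + C2) ^+ 2 * 4 ^+ n)).
  by lra.
move=> v g e hs /andP[e0 e1].
have hv := sol_C11 hs; have hj := sol_jet hs.
have e01 : 0 < e <= 1 by rewrite e0 e1.
have hd : C11 3 (dil (1 + e) v) (dilg (1 + e) g).
  by apply: C11_dil hj _; apply/andP; split; lra.
pose z x := dil (1 + e) v x - v x; pose dz x := dilg (1 + e) g x - g x.
have hz : C11 3 z dz by exact: C11B.
have Ez : energy (dil (1 + e) v) (dilg (1 + e) g) =
    energy (fun x => v x + z x) (fun x => g x + dz x).
  by congr energy; apply/funext => x; rewrite /z /dz addrCA subrr addr0.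
have ec : 0 <= e ^+ 2 by exact: sqr_ge0.
have zE x : `|x| <= 2 -> `|z x - e * euler v g x| <= C1 * e ^+ 2.
  exact: dil_expand.
have zB x : `|x| <= 2 -> `|z x| <= (C1 + C2) * e.
  move=> hx; have -> : z x = (z x - e * euler v g x) + e * euler v g x by ring.
  apply: le_trans (ler_normD _ _) _; rewrite mulrDl lerD //.
    apply: le_trans (zE _ hx) _; rewrite ler_wpM2l // expr2 -[leRHS]mul1r.
    by rewrite ler_wpM2r // ltW.
  rewrite normrM (ger0_norm (ltW e0)) mulrC ler_wpM2r ?(ltW e0) //.
  exact: euler_bound.
have bv := C11_bdd3 hv; have bg := C11_bddv hv; have bz := C11_bdd3 hz; have bdz := C11_bddv hz.
(* On {g = 0} one has Zv = - 2 v >= 0, so z >= - C1 e^2 there; adding this constant makes the test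
   function admissible, at the price given by [wlape_cst_bound]. *)
have w1 : - (C1 * e ^+ 2 * W) <= wlape g z dz.
  have hc : C11 3 (fun x => C1 * e ^+ 2 * 1) (fun x : V => (C1 * e ^+ 2) *: 0).
    exact: C11Z _ (C11_cst 1).
  have : 0 <= wlape g (fun x => z x + C1 * e ^+ 2 * 1) (fun x => dz x + (C1 * e ^+ 2) *: 0).
    apply: (sol_wlape_ge0 hs); first exact: C11D.
    move=> x hx gx; have := zE _ hx; rewrite ler_norml => /andP[+ _].
    have : 0 <= e * euler v g x.
      rewrite mulr_ge0 ?(ltW e0) // /euler gx -(scale0r x) dotZr mul0r.
      by have := sol_npos hs hx gx; lra.
    lra.
  rewrite wlapeD // (wlapeZ (C1 * e ^+ 2) bg (C11_cst 1)).
  have cc0 : 0 <= C1 * e ^+ 2 by rewrite mulr_ge0.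
  by have := ler_wpM2l cc0 (wlape_cst_bound hs); rewrite -/W; lra.
have w2 : - (6 * (C1 * e ^+ 2 * C2)) * 4 ^+ n <= integ (fun x => wt x * (z x * euler v g x)).
  apply: integ_ge_cst; first by rewrite /euler; bddt.
  move=> x hx; have /andP[h0 h6] := wt_bound x.
  have hh : - (C1 * e ^+ 2 * C2) <= z x * euler v g x.
    have -> : z x * euler v g x = e * euler v g x ^+ 2 + (z x - e * euler v g x) * euler v g x.
      by ring.
    have : 0 <= e * euler v g x ^+ 2 by rewrite mulr_ge0 ?sqr_ge0 // ltW.
    have : `|(z x - e * euler v g x) * euler v g x| <= C1 * e ^+ 2 * C2.
      by rewrite normrM ler_pM //; [exact: zE|exact: euler_bound].
    rewrite ler_norml => /andP[]; lra.
  have q0 : 0 <= C1 * e ^+ 2 * C2 by rewrite mulr_ge0 // mulr_ge0.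
  have : wt x * - (C1 * e ^+ 2 * C2) <= wt x * (z x * euler v g x) by rewrite ler_wpM2l.
  have : wt x * (C1 * e ^+ 2 * C2) <= 6 * (C1 * e ^+ 2 * C2) by rewrite ler_wpM2r.
  lra.
have w3 : 0 * 4 ^+ n <= integ (fun x => cutoff x * dot (dz x) (dz x)).
  apply: integ_ge_cst; first by bddt.
  by move=> x _; rewrite mulr_ge0 ?dot_ge0 //; case/andP: (cutoff_bound x).
have w4 : integ (fun x => z x ^+ 2 * wt x) <= 6 * ((C1 + C2) * e) ^+ 2 * 4 ^+ n.
  apply: le_trans (ler_norm _) _; apply: norm_integ_le => x hx.
  have /andP[h0 h6] := wt_bound x.
  rewrite normrM (ger0_norm h0) mulrC ler_pM // normrX lerXn2r ?nnegrE //.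
    by rewrite mulr_ge0 ?(ltW e0) // addr_ge0.
  exact: zB.
rewrite Ez (energyD hv hz).
have r1 : 6 * ((C1 + C2) * e) ^+ 2 * 4 ^+ n = 6 * ((C1 + C2) ^+ 2 * 4 ^+ n) * e ^+ 2 by ring.
have r2 : 6 * (C1 * e ^+ 2 * C2) * 4 ^+ n = 6 * (C1 * C2 * 4 ^+ n) * e ^+ 2 by ring.
have r3 : C1 * e ^+ 2 * W = C1 * W * e ^+ 2 by ring.
lra.
Qed.

Definition monneau (A : 'M[R]_n) v : R := integ (fun x => wt x * (v x - quadp A x) ^+ 2).

(** In the square of v - q plus the increment, the cross term is 2 e b (v - q) Zv up to O(e^2) and
    is rewritten by [monneau_identity]; the squared increment and the energy gap are nonnegative and
    are dropped. *)
Lemma monneau_step (K : R) (A : 'M[R]_n) : A^T = A -> \tr A = 1 -> 0 <= K ->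
  exists2 C, 0 <= C & forall v g e, sol K v g -> 0 < e <= 1 ->
    energy (quadp A) (qgrad A) <= energy v g ->
    - (2 * e * wlape g (fun x => v x - quadp A x) (fun x => g x - qgrad A x)) - C * e ^+ 2
      <= monneau A (dil (1 + e) v) - monneau A v.
Proof.
move=> sA A1 K0; pose C1 := (9 + 4 * n%:R) * K; pose C3 := K + n%:R ^+ 2 * `|A| * 2 ^+ 2.
have c4 : 0 < 4 ^+ n :> R by rewrite exprn_gt0.
have C10 : 0 <= C1 by rewrite mulr_ge0 // addr_ge0 // mulr_ge0.
have C30 : 0 <= C3 by rewrite addr_ge0 // !mulr_ge0 ?sqr_ge0.
exists (12 * (C3 * C1 * 4 ^+ n)); first by rewrite !mulr_ge0 // ltW.
move=> v g e hs /andP[e0 e1] hE.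
have hv := sol_C11 hs; have hj := sol_jet hs.
have e01 : 0 < e <= 1 by rewrite e0 e1.
have hq := C11_quadp sA (ler0n R 3).
have hd : C11 3 (dil (1 + e) v) (dilg (1 + e) g).
  by apply: C11_dil hj _; apply/andP; split; lra.
have bv := C11_bdd3 hv; have bg := C11_bddv hv; have bd := C11_bdd3 hd.
have bq := C11_bdd3 hq; have bdq := C11_bddv hq.
have hid := monneau_identity sA A1 hv.
have ec : 0 <= e ^+ 2 by exact: sqr_ge0.
have : integ (fun x => 2 * e * (wt x * ((v x - quadp A x) * euler v g x)) - 12 * (C3 * C1) * e ^+ 2)
    <= monneau A (dil (1 + e) v) - monneau A v.
  rewrite /monneau -integB; [|by bddt..].
  apply: le_integ; [by rewrite /euler; bddt|by bddt|].
  move=> x hx; have /andP[h0 h6] := wt_bound x.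
  have hz := dil_expand hj e01 hx; rewrite -/C1 in hz.
  set z := dil (1 + e) v x in hz *; set Z := euler v g x in hz *.
  have hw : `|v x - quadp A x| <= C3.
    have hx6 : `|x| <= 6 by lra.
    have [a _ _] := hj _ _ hx6 hx6.
    apply: le_trans (ler_normB _ _) _; apply: lerD => //.
    apply: le_trans (quadp_bound _ _) _.
    by rewrite ler_wpM2l ?mulr_ge0 ?sqr_ge0 // lerXn2r ?nnegrE.
  set w := v x - quadp A x in hw *.
  have -> : z - quadp A x = w + (z - v x) by rewrite /w; ring.
  have h1 : `|w * (z - v x - e * Z)| <= C3 * (C1 * e ^+ 2) by rewrite normrM ler_pM.
  have h2 : wt x * (- (C3 * (C1 * e ^+ 2))) <= wt x * (w * (z - v x - e * Z)).
    by rewrite ler_wpM2l //; move: h1; rewrite ler_norml => /andP[].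
  have h3 : wt x * (C3 * (C1 * e ^+ 2)) <= 6 * (C3 * (C1 * e ^+ 2)).
    by rewrite ler_wpM2r // mulr_ge0 // mulr_ge0.
  have h4 : 0 <= wt x * (z - v x) ^+ 2 by rewrite mulr_ge0 ?sqr_ge0.
  have -> : wt x * (w + (z - v x)) ^+ 2 - wt x * w ^+ 2 =
     2 * (wt x * (w * (z - v x - e * Z))) + 2 * e * (wt x * (w * Z)) + wt x * (z - v x) ^+ 2.
    by ring.
  lra.
rewrite integB; [|by rewrite /euler; bddt|by bddt].
rewrite integ_cst integZ ?hid; last by rewrite /euler; bddt.
have : 0 <= 2 * e * (energy v g - energy (quadp A) (qgrad A)).
  by rewrite mulr_ge0 ?subr_ge0 // mulr_ge0 // ltW.
lra.
Qed.

End Steps.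

(** * Blow-ups *)

(** Go from s to r in N equal steps. With T = (r - s) / s each relative step is at most T / N, so
    the total loss is at most N C (T / N)^2, which tends to 0. *)
Lemma almost_nondecreasing (R : realType) (f : R -> R) (r0 C : R) : 0 <= C ->
  (forall r e, 0 < r -> 0 < e <= 1 -> r * (1 + e) <= r0 -> f r - C * e ^+ 2 <= f (r * (1 + e))) ->
  forall s r, 0 < s -> s <= r -> r <= r0 -> f s <= f r.
Proof.
move=> C0 h s r s0; rewrite le_eqVlt => /predU1P[-> //|sr] rr0.
apply/ler_addgt0Pr => e e0.
pose d := r - s; have d0 : 0 < d by rewrite subr_gt0.
pose T := d / s; have T0 : 0 < T by rewrite divr_gt0.
(* The three summands bring the total loss below e, the relative step below 1, and N above 0. *)
have [N hN] : exists N : nat, C * T ^+ 2 / e + T + 1 <= N%:R.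
  by exists (Num.truncn (C * T ^+ 2 / e + T + 1)).+1; rewrite ltW // truncnS_gt.
have q0 : 0 <= C * T ^+ 2 / e.
  by rewrite divr_ge0 ?(ltW e0) // mulr_ge0 // sqr_ge0.
have N0 : 0 < N%:R :> R by lra.
pose t := T / N%:R.
have t0 : 0 < t by rewrite divr_gt0.
have t1 : t <= 1 by rewrite ler_pdivrMr // mul1r; lra.
have tE : t * s = d / N%:R by rewrite /t /T; field; rewrite !gt_eqF.
pose sk k := s + k%:R * (t * s).
have st0 : 0 < t * s by rewrite mulr_gt0.
have skN : sk N = r by rewrite /sk tE /d; field; rewrite gt_eqF.
have main k : (k <= N)%N -> f s - k%:R * (C * t ^+ 2) <= f (sk k).
  elim: k => [|k IH] kN; first by rewrite /sk !mul0r addr0 subr0.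
  have sk0 : s <= sk k by rewrite /sk lerDl mulr_ge0 // ltW.
  have skp : 0 < sk k by exact: lt_le_trans sk0.
  pose ek := t * s / sk k.
  have ekt : ek <= t by rewrite ler_pdivrMr // ler_wpM2l // ltW.
  have ek0 : 0 < ek by rewrite divr_gt0.
  have E : sk k * (1 + ek) = sk k.+1.
    by rewrite /ek mulrDr mulr1 mulrCA mulfV ?gt_eqF // mulr1 /sk -[k.+1%:R]natr1; ring.
  have le0 : sk k * (1 + ek) <= r0.
    rewrite E; apply: le_trans rr0; rewrite -skN /sk lerD2l ler_wpM2r ?(ltW st0) //.
    by rewrite ler_nat.
  have ek01 : 0 < ek <= 1 by rewrite ek0 (le_trans ekt).
  have := h _ _ skp ek01 le0; rewrite E => hk.
  have := IH (ltnW kN).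
  have : C * ek ^+ 2 <= C * t ^+ 2.
    by rewrite ler_wpM2l // lerXn2r ?nnegrE ?(ltW ek0) ?(ltW t0).
  by rewrite -[k.+1%:R]natr1 mulrDl mul1r; lra.
have := main N (leqnn N); rewrite skN.
suff : N%:R * (C * t ^+ 2) <= e by lra.
have -> : N%:R * (C * t ^+ 2) = C * T ^+ 2 / N%:R by rewrite /t; field; rewrite gt_eqF.
rewrite ler_pdivrMr // [e * _]mulrC -ler_pdivrMr //; lra.
Qed.

(** * Comparison of norms, gradients from Taylor bounds, mean value theorem *)

Section Gradient.
Variables (R : realType) (n : nat).
Notation V := 'rV[R]_n.
Implicit Types (x y a b : V) (f u : V -> R).

Lemma enorm2 x : enorm x ^+ 2 = dot x x.
Proof.
rewrite /enorm sqr_sqrtr; last by apply: sumr_ge0 => i _; rewrite sqr_ge0.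
by apply: eq_bigr => i _; rewrite expr2.
Qed.

Lemma enorm_ge0 x : 0 <= enorm x.
Proof. exact: sqrtr_ge0. Qed.

Lemma norm_le_enorm x : `|x| <= enorm x.
Proof.
apply/norm_leP => [|i]; first exact: enorm_ge0.
rewrite -ler_sqr ?nnegrE ?enorm_ge0 // real_normK ?num_real // enorm2.
rewrite /dot (bigD1 i) //= -expr2 lerDl.
by apply: sumr_ge0 => j _; rewrite -expr2 sqr_ge0.
Qed.

Lemma enorm_le_norm x : enorm x <= n%:R * `|x|.
Proof.
rewrite -ler_sqr ?nnegrE ?enorm_ge0 ?mulr_ge0 // enorm2.
apply: le_trans (ler_norm _) _; apply: le_trans (norm_dot _ _) _.
rewrite exprMn -expr2 ler_wpM2r ?sqr_ge0 // expr2.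
case: n => [|k]; first by rewrite mul0r.
by rewrite -{1}[k.+1%:R]mulr1 ler_wpM2l // ler1n.
Qed.

Lemma derive_taylor f x v (c K d : R) : 0 < d ->
  (forall t : R, `|t| < d -> `|f (x + t *: v) - f x - t * c| <= K * t ^+ 2) ->
  'D_v f x = c.
Proof.
move=> d0 h; apply: cvg_lim => //; apply/cvgrPdist_le => e e0.
have m0 : 0 < Num.min d (e / (`|K| + 1)).
  by rewrite lt_min d0 divr_gt0 //; have := normr_ge0 K; lra.
near=> t.
have t0 : t != 0 by near: t; exact: nbhs_dnbhs_neq.
have : `|t| < Num.min d (e / (`|K| + 1)) by near: t; exact: dnbhs0_lt.
rewrite lt_min => /andP[td te].
rewrite /= /GRing.scale /= -[x in f x]addrC.
have -> : c - t^-1 * (f (x + t *: v) - f x) = - t^-1 * (f (x + t *: v) - f x - t * c).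
  by field.
rewrite normrM normrN normfV mulrC ler_pdivrMr ?normr_gt0 //.
apply: le_trans (h _ td) _; rewrite -real_normK ?num_real // expr2 mulrA ler_wpM2r //.
apply: (@le_trans _ _ ((`|K| + 1) * `|t|)).
  by rewrite ler_wpM2r //; have := ler_norm K; lra.
rewrite mulrC -ler_pdivlMr ?(ltW te) //; by have := normr_ge0 K; lra.
Unshelve. all: end_near. Qed.

Lemma grad_quadp (B : 'M[R]_n) x : B^T = B -> grad (quadp B) x = qgrad B x.
Proof.
move=> sB; apply/rowP => i; rewrite mxE.
apply: (@derive_taylor _ _ _ _ (n%:R ^+ 2 * `|B|) 1) => // t t1.
have := quadp_taylor x (x + t *: evec R i) sB.
have -> : x + t *: evec R i - x = t *: evec R i by rewrite addrC addKr.
rewrite dotZr dot_evec => /le_trans; apply.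
rewrite ler_wpM2l ?mulr_ge0 ?sqr_ge0 // -[leRHS]real_normK ?num_real //.
have ht : `|t *: evec R i| <= `|t|.
  by rewrite normrZ -[leRHS]mulr1 ler_wpM2l // norm_evec.
by rewrite lerXn2r ?nnegrE.
Qed.

Lemma derive_dot u x v : differentiable u x -> 'D_v u x = dot (grad u x) v.
Proof.
move=> du; rewrite deriveE // [v in LHS]row_sum_delta linear_sum /=.
apply: eq_bigr => i _; rewrite linearZ /= mxE deriveE // mulrC; congr (_ * _).
Qed.

Lemma mean_value u a b : (forall t : R, 0 <= t <= 1 -> differentiable u (a + t *: (b - a))) ->
  exists2 t : R, 0 <= t <= 1 & u b - u a = dot (grad u (a + t *: (b - a))) (b - a).
Proof.
move=> du; pose phi (t : R) := u (a + t *: (b - a)).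
have dphi (t : R) : 0 <= t <= 1 ->
    is_derive t (1 : R) phi (dot (grad u (a + t *: (b - a))) (b - a)).
  move=> ht; have dut := du t ht.
  have E : (fun h : R => h^-1 *: ((phi \o shift t) (h *: 1) - phi t)) =
      (fun h => h^-1 *: ((u \o shift (a + t *: (b - a))) (h *: (b - a)) - u (a + t *: (b - a)))).
    apply/funext => h; congr (_ *: (_ - _)); rewrite /phi /=; congr u.
    by rewrite [h *: 1]mulr1 scalerDl addrCA.
  apply: DeriveDef; first by rewrite /derivable E; exact: diff_derivable.
  by rewrite /derive E; exact: derive_dot.
have [|||t ht] := @MVT_segment R phi (fun t => dot (grad u (a + t *: (b - a))) (b - a)) 0 1.
- exact: ler01.
- by move=> t; rewrite in_itv /= => /andP[h0 h1]; apply: dphi; rewrite !ltW.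
- apply: derivable_within_continuous => t; rewrite in_itv /= => ht.
  by have := dphi t ht => -[].
rewrite /phi scale1r scale0r addr0 subr0 mulr1 => E; exists t; first by move: ht; rewrite in_itv.
by rewrite -E; congr (u _ - _); rewrite addrCA subrr addr0.
Qed.

End Gradient.

(** * Rescalings of a solution *)

Section Blowup.
Variables (R : realType) (n : nat) (u : 'rV[R]_n -> R) (M : R).
Notation V := 'rV[R]_n.
Implicit Types (x y a b : V) (r : R).
Hypothesis M0 : 0 < M.
Hypothesis du : forall x, B1 x -> differentiable u x.
Hypothesis gM : forall x y, B1 x -> B1 y ->
  enorm (grad u x - grad u y) <= M * enorm (x - y).
Hypothesis ae : Defs.null_set [set x | B1 x /\
  ~ ((forall i, derivable (fun y => 'D_(evec R i) u y) x (evec R i)) /\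
     lap u x = (if grad u x != 0 then 1 else 0))].
Hypothesis grad0 : grad u 0 = 0.
Hypothesis npos : forall x, B1 x -> grad u x = 0 -> u x <= u 0.

Lemma B1_cube x : n%:R * `|x| < 1 -> B1 x.
Proof. by rewrite /B1 /eball /= subr0; apply: le_lt_trans; exact: enorm_le_norm. Qed.

(** Lipschitz constant of the gradient in the sup norm; the factor n compares the two norms, and
    [tlip] gains another n from the bound on [dot]. *)
Definition glip : R := M * n%:R.
Definition tlip : R := n%:R * glip.

Lemma glip_ge0 : 0 <= glip. Proof. by rewrite mulr_ge0 // ltW. Qed.
Lemma tlip_ge0 : 0 <= tlip. Proof. by rewrite mulr_ge0 // glip_ge0. Qed.

Lemma grad_lip x y : B1 x -> B1 y -> `|grad u x - grad u y| <= glip * `|x - y|.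
Proof.
move=> hx hy; apply: le_trans (norm_le_enorm _) _; apply: le_trans (gM hx hy) _.
by rewrite -mulrA ler_wpM2l ?(ltW M0) // enorm_le_norm.
Qed.

(** The condition n P < 1 puts the sup-norm ball of radius P inside [B1]. The mean value theorem
    yields the gradient at a point of the segment, which [grad_lip] compares with the gradient at
    [a]. *)
Lemma taylor_u (P : R) a b : n%:R * P < 1 -> `|a| <= P -> `|b| <= P ->
  `|u b - u a - dot (grad u a) (b - a)| <= tlip * `|b - a| ^+ 2.
Proof.
move=> hP ha hb.
have inB x : `|x| <= P -> B1 x.
  by move=> hx; apply: B1_cube; apply: le_lt_trans hP; rewrite ler_wpM2l.
have seg (t : R) : 0 <= t <= 1 -> `|a + t *: (b - a)| <= P.
  move=> /andP[t0 t1].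
  have -> : a + t *: (b - a) = (1 - t) *: a + t *: b.
    by rewrite scalerBr scalerBl scale1r addrA addrAC.
  apply: le_trans (ler_normD _ _) _; rewrite !normrZ (ger0_norm t0) ger0_norm ?subr_ge0 //.
  have : (1 - t) * `|a| <= (1 - t) * P by rewrite ler_wpM2l // subr_ge0.
  have : t * `|b| <= t * P by rewrite ler_wpM2l.
  by lra.
have [|t ht ->] := @mean_value _ _ u a b; first by move=> t /seg /inB /du.
rewrite -dotNl -dotDl; apply: le_trans (norm_dot _ _) _.
rewrite /tlip -mulrA ler_wpM2l // expr2 mulrA ler_wpM2r //.
apply: le_trans (grad_lip (inB _ (seg _ ht)) (inB _ ha)) _.
rewrite ler_wpM2l ?glip_ge0 // addrC addKr normrZ -[leRHS]mul1r ler_wpM2r //.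
by case/andP: ht => h0 h1; rewrite ger0_norm.
Qed.

Definition blg r x : V := r^-1 *: grad u (r *: x).

Lemma rescE r x : resc u 0 r x = (u (r *: x) - u 0) / r ^+ 2.
Proof. by rewrite /resc add0r. Qed.

Lemma resc0 r : resc u 0 r 0 = 0.
Proof. by rewrite rescE scaler0 subrr mul0r. Qed.

Lemma blg0 r : blg r 0 = 0.
Proof. by rewrite /blg scaler0 grad0 scaler0. Qed.

Lemma taylor_resc r (P : R) x y : 0 < r -> n%:R * (r * P) < 1 -> `|x| <= P -> `|y| <= P ->
  `|resc u 0 r y - resc u 0 r x - dot (blg r x) (y - x)| <= tlip * `|y - x| ^+ 2.
Proof.
move=> r0 hP hx hy.
have sc (z : V) : `|z| <= P -> `|r *: z| <= r * P.
  by move=> hz; rewrite normrZ (ger0_norm (ltW r0)) ler_wpM2l // ltW.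
have := taylor_u hP (sc _ hx) (sc _ hy).
rewrite -scalerBr dotZr normrZ (ger0_norm (ltW r0)) exprMn => h.
have -> : resc u 0 r y - resc u 0 r x - dot (blg r x) (y - x) =
  (u (r *: y) - u (r *: x) - r * dot (grad u (r *: x)) (y - x)) / r ^+ 2.
  by rewrite !rescE /blg dotZl; field; rewrite gt_eqF.
rewrite normrM normfV [`|r ^+ 2|]ger0_norm ?sqr_ge0 // ler_pdivrMr ?exprn_gt0 //.
by apply: le_trans h _; rewrite mulrCA mulrC.
Qed.

Lemma blg_lip r (P : R) x y : 0 < r -> n%:R * (r * P) < 1 -> `|x| <= P -> `|y| <= P ->
  `|blg r x - blg r y| <= glip * `|x - y|.
Proof.
move=> r0 hP hx hy.
have inB (z : V) : `|z| <= P -> B1 (r *: z).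
  move=> hz; apply: B1_cube; apply: le_lt_trans hP; rewrite ler_wpM2l //.
  by rewrite normrZ (ger0_norm (ltW r0)) ler_wpM2l // ltW.
rewrite /blg -scalerBr normrZ normfV (ger0_norm (ltW r0)) mulrC ler_pdivrMr //.
apply: le_trans (grad_lip (inB _ hx) (inB _ hy)) _.
by rewrite -scalerBr normrZ (ger0_norm (ltW r0)) [r * _]mulrC mulrA.
Qed.

Lemma grad_resc r x : 0 < r -> n%:R * (r * (`|x| + 1)) < 1 -> grad (resc u 0 r) x = blg r x.
Proof.
move=> r0 h; apply/rowP => i; rewrite mxE.
apply: (@derive_taylor _ _ _ _ _ _ tlip 1) => // t t1.
have hx : `|x| <= `|x| + 1 by rewrite lerDl.
have ht : `|t *: evec R i| <= `|t|.
  by rewrite normrZ -[leRHS]mulr1 ler_wpM2l // norm_evec.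
have hy : `|x + t *: evec R i| <= `|x| + 1.
  by apply: le_trans (ler_normD _ _) _; rewrite lerD2l (le_trans ht) // ltW.
have := taylor_resc r0 h hx hy.
have -> : x + t *: evec R i - x = t *: evec R i by rewrite addrC addKr.
rewrite dotZr dot_evec => /le_trans; apply.
rewrite ler_wpM2l ?tlip_ge0 // -[leRHS]real_normK ?num_real //.
by rewrite lerXn2r ?nnegrE.
Qed.

Lemma differentiable_resc r x : B1 (r *: x) -> differentiable (resc u 0 r) x.
Proof.
move=> hx; have du' := du hx.
have -> : resc u 0 r = (fun y => r ^- 2 *: (u (r *: y) - u 0)).
  by apply/funext => y; rewrite rescE mulrC.
apply: differentiableZ; apply: differentiableB => //.
by apply: (@differentiable_comp _ _ _ _ (fun y : V => r *: y) u).
Qed.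

(** For r <= [rmax] the cube of half side 6 r lies in [B1]; the summand 1 makes the inequality
    strict. *)
Definition rmax : R := (6 * n%:R + 1)^-1.

Lemma rmax_gt0 : 0 < rmax.
Proof. by rewrite invr_gt0 ltr_wpDl // mulr_ge0. Qed.

Lemma rmax_cube r : 0 < r <= rmax -> n%:R * (r * 6) < 1.
Proof.
move=> /andP[r_gt0 rr0]; have p : 0 < 6 * n%:R + 1 :> R by rewrite ltr_wpDl // mulr_ge0.
have : r * (6 * n%:R + 1) <= 1 by rewrite -ler_pdivlMr // div1r.
by lra.
Qed.

(** Since u_r and its gradient vanish at 0, on |x| <= 6 they are bounded by 36 [tlip] and 6 [glip].
    The sum also dominates [tlip] and [glip], so it serves as the [K] of [sol]. *)
Definition blowup_bound : R := 36 * tlip + 6 * glip.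

Lemma blowup_bound_ge0 : 0 <= blowup_bound.
Proof. by have := tlip_ge0; have := glip_ge0; rewrite /blowup_bound; lra. Qed.

Lemma null_scale r (N : set V) : 0 < r -> Defs.null_set N ->
  Defs.null_set [set x | N (r *: x)].
Proof.
move=> r_gt0 N0 e e0; have er : 0 < e * r ^+ n by rewrite mulr_gt0 // exprn_gt0.
have [c [h [h0 [Nc hs]]]] := N0 _ er.
exists (fun k => r^-1 *: c k), (fun k => h k / r); split; [|split].
- by move=> k; rewrite divr_gt0.
- move=> x /= /Nc [k _ hk]; exists k => // i; have := hk i; rewrite !mxE => hki.
  rewrite ltr_pdivlMr // -{2}(gtr0_norm r_gt0) -normrM mulrBl mulrAC mulVf ?gt_eqF // mul1r.
  by rewrite mulrC.
- move=> m; have := hs m; rewrite -ler_pdivrMr ?exprn_gt0 // mulr_suml.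
  by apply: le_trans; rewrite le_eqVlt; apply/orP; left; apply/eqP/eq_bigr => k _;
    rewrite mulrA exprMn exprVn.
Qed.

(** The quotient of [blg r] with step 2^-j is that of the gradient of [u] at r x with step r 2^-j,
    so each summand tends to the corresponding pure second derivative. *)
Lemma dquot_blg r x : 0 < r ->
  (forall i, derivable (fun y => 'D_(evec R i) u y) (r *: x) (evec R i)) ->
  dquot (blg r) j x @[j --> \oo] --> lap u (r *: x).
Proof.
move=> r_gt0 hd; rewrite /dquot /lap.
apply: (@cvg_big R 'I_n +%R 0 xpredT (@add_continuous R)) => i _.
have hj : (fun j : nat => r * 2 ^- j) @ \oo --> (0 : R).
  rewrite -[X in _ --> X](mulr0 r); apply: cvgMr.
  apply/cvgrPdist_le => e e0; apply: filterS (step_le e0) => j hj.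
  by rewrite sub0r normrN ger0_norm // ltW // step_gt0.
have hj0 j : r * 2 ^- j != 0 by rewrite gt_eqF // mulr_gt0 // step_gt0.
have := hd i; rewrite /derivable => /cvg_ex[l hl].
have El : 'D_(evec R i) (fun y => 'D_(evec R i) u y) (r *: x) = l by apply: cvg_lim hl.
rewrite El.
have /cvgr_dnbhsP := hl.
move=> /(_ (fun j => r * 2 ^- j) (conj hj0 hj)).
apply: cvg_trans; apply: near_eq_cvg; near=> j.
have t0 := step_gt0 R j.
have E1 : r *: (x + 2 ^- j *: evec R i) = (r * 2 ^- j) *: evec R i + r *: x.
  by rewrite scalerDr scalerA addrC.
transitivity ((r * 2 ^- j)^-1 * ('D_(evec R i) u ((r * 2 ^- j) *: evec R i + r *: x) -
   'D_(evec R i) u (r *: x))) => //.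
by rewrite /blg E1 !mxE; field; rewrite expf_neq0 // gt_eqF.
Unshelve. all: end_near. Qed.

Lemma sol_resc r : 0 < r <= rmax -> sol blowup_bound (resc u 0 r) (blg r).
Proof.
move=> hr; have /andP[r_gt0 rr0] := hr; have h6 := rmax_cube hr.
have t0 := tlip_ge0; have g0 := glip_ge0.
have z6 : `|0 : V| <= 6 by rewrite normr0.
split.
- move=> x y hx hy; split.
  + have := taylor_resc r_gt0 h6 z6 hx; rewrite resc0 blg0 -(scale0r x) dotZl mul0r !subr0.
    rewrite scale0r subr0 => /le_trans; apply.
    have : tlip * `|x| ^+ 2 <= tlip * 6 ^+ 2 by rewrite ler_wpM2l // lerXn2r ?nnegrE.
    by rewrite /blowup_bound; lra.
  + have := blg_lip r_gt0 h6 hx z6; rewrite blg0 !subr0 => /le_trans; apply.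
    have : glip * `|x| <= glip * 6 by rewrite ler_wpM2l.
    by rewrite /blowup_bound; lra.
  + apply: le_trans (taylor_resc r_gt0 h6 hx hy) _.
    by rewrite ler_wpM2r ?sqr_ge0 // /blowup_bound; lra.
- move=> x y hx hy; apply: le_trans (blg_lip r_gt0 h6 hx hy) _.
  by rewrite ler_wpM2r // /blowup_bound; lra.
- exists [set x | [set x | B1 x /\
    ~ ((forall i, derivable (fun y => 'D_(evec R i) u y) x (evec R i)) /\
       lap u x = (if grad u x != 0 then 1 else 0))] (r *: x)].
    exact: null_scale.
  move=> x hx /= /not_andP[|/contrapT [hd hl]].
    case; apply: B1_cube; apply: le_lt_trans h6; rewrite ler_wpM2l // normrZ.
    by rewrite (ger0_norm (ltW r_gt0)) ler_wpM2l ?(ltW r_gt0) //; lra.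
  have -> : (if blg r x != 0 then 1 else 0) = lap u (r *: x).
    by rewrite hl /blg scaler_eq0 invr_eq0 gt_eqF.
  exact: dquot_blg.
- move=> x hx /eqP; rewrite scaler_eq0 invr_eq0 gt_eqF //= => /eqP gx.
  rewrite rescE mulr_le0_ge0 ?invr_ge0 ?sqr_ge0 // subr_le0; apply: npos => //.
  apply: B1_cube; apply: le_lt_trans h6; rewrite ler_wpM2l // normrZ.
  by rewrite (ger0_norm (ltW r_gt0)) ler_wpM2l ?(ltW r_gt0) //; lra.
Qed.

Lemma dil_resc r (lam : R) : r != 0 -> lam != 0 ->
  dil lam (resc u 0 r) = resc u 0 (r * lam).
Proof.
move=> r_neq0 l0; apply/funext => x; rewrite /dil !rescE scalerA.
by field; rewrite r_neq0 l0.
Qed.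

Lemma dilg_blg r (lam : R) : dilg lam (blg r) = blg (r * lam).
Proof. by apply/funext => x; rewrite /dilg /blg !scalerA invfM mulrC. Qed.

Let bl (r : R) : V -> R := resc u 0 r.

Lemma dil_sol r e : 0 < r -> 0 < e <= 1 ->
  dil (1 + e) (bl r) = bl (r * (1 + e)) /\ dilg (1 + e) (blg r) = blg (r * (1 + e)).
Proof.
move=> r_gt0 /andP[e0 _]; split; last exact: dilg_blg.
by apply: dil_resc; rewrite gt_eqF //; lra.
Qed.

Lemma le_rmax r e : 0 < r -> 0 < e <= 1 -> r * (1 + e) <= rmax -> 0 < r <= rmax.
Proof.
move=> r_gt0 /andP[e0 _] h; rewrite r_gt0 /= (le_trans _ h) //.
by rewrite mulrDr mulr1 lerDl mulr_ge0 // ltW.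
Qed.

Lemma energy_mono s r : 0 < s -> s <= r -> r <= rmax ->
  energy (bl s) (blg s) <= energy (bl r) (blg r).
Proof.
have [C C0 hC] := @energy_step R n _ blowup_bound_ge0.
apply: (@almost_nondecreasing _ (fun r => energy (bl r) (blg r)) rmax C C0) => {s}r e hr he hre.
have := hC _ _ _ (sol_resc (le_rmax hr he hre)) he.
by have [-> ->] := dil_sol hr he.
Qed.

(** * Monneau monotonicity and convergence of the whole family *)

Section Limit.
Variable A : 'M[R]_n.
Hypothesis sA : A^T = A.
Hypothesis A1 : \tr A = 1.
Hypothesis subseq_cvg : forall d r1 : R, 0 < d -> 0 < r1 ->
  exists2 s : R, 0 < s <= r1 & forall x, `|x| <= 2 -> `|bl s x - quadp A x| <= d.

Let c4 : 0 < 4 ^+ n :> R. Proof. by rewrite exprn_gt0. Qed.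

(** By [energy_mono] a small scale s with u_s close to q suffices. Expanding about q leaves no
    first-order term, and the Dirichlet term of u_s - q is nonnegative, so only the weighted square
    of u_s - q has to be small: closeness of values is enough. *)
Lemma energy_ge_quad r : 0 < r <= rmax ->
  energy (quadp A) (qgrad A) <= energy (bl r) (blg r).
Proof.
move=> /andP[r_gt0 rr0]; apply/ler_addgt0Pr => e e0.
pose d := Num.min 1 (e / (12 * 4 ^+ n)).
have d0 : 0 < d by rewrite lt_min ltr01 divr_gt0 // mulr_gt0.
have d1 : d <= 1 by rewrite ge_min lexx.
have de : 12 * d * 4 ^+ n <= e.
  have : d <= e / (12 * 4 ^+ n) by rewrite ge_min lexx orbT.
  by rewrite ler_pdivlMr ?mulr_gt0 //; lra.
have [s /andP[s0 sr] hs] := subseq_cvg d0 r_gt0.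
have hsr : 0 < s <= rmax by rewrite s0 (le_trans sr).
apply: le_trans (_ : energy (bl s) (blg s) + e <= _); last first.
  by rewrite lerD2r; exact: energy_mono.
have hq := C11_quadp sA (ler0n R 3).
have hv := sol_C11 (sol_resc hsr).
have hw := C11B hv hq.
have bw := C11_bdd3 hw; have bdw := C11_bddv hw.
have E : energy (bl s) (blg s) = energy (fun x => quadp A x + (bl s x - quadp A x))
                             (fun x => qgrad A x + (blg s x - qgrad A x)).
  by congr energy; apply/funext => x; rewrite addrCA subrr addr0.
rewrite E (energyD hq hw) (wlape_quad A1 hw).
rewrite (@eq_integ _ _ (fun x => wt x * _) (fun=> 0)) ?integ_cst; last first.
  by move=> x _; rewrite euler_quadp !mulr0.
have h1 : 0 * 4 ^+ n <= integ (fun x => cutoff x * dot (blg s x - qgrad A x) (blg s x - qgrad A x)).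
  apply: integ_ge_cst; first by bddt.
  by move=> x _; rewrite mulr_ge0 ?dot_ge0 //; case/andP: (cutoff_bound x).
have h2 : integ (fun x => (bl s x - quadp A x) ^+ 2 * wt x) <= 6 * d * 4 ^+ n.
  apply: le_trans (ler_norm _) _; apply: norm_integ_le => x hx.
  have /andP[w0 w6] := wt_bound x.
  rewrite normrM (ger0_norm w0) mulrC ler_pM // normrX.
  apply: (@le_trans _ _ (d ^+ 2)); first by rewrite lerXn2r ?nnegrE ?(ltW d0) ?hs.
  by rewrite expr2 -[leRHS]mul1r ler_wpM2r // ltW.
lra.
Qed.

Lemma n_gt0 : (0 < n)%N.
Proof.
rewrite lt0n; apply/eqP => n0; move: A1; rewrite /mxtrace big1 => [/eqP|i _].
  by rewrite eq_sym oner_eq0.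
by have := ltn_ord i; rewrite {2}n0.
Qed.

Let nR : 0 < n%:R :> R. Proof. by rewrite ltr0n n_gt0. Qed.

Definition iso : 'M[R]_n := (n%:R^-1)%:M.

Lemma iso_sym : iso^T = iso. Proof. exact: tr_scalar_mx. Qed.

Lemma iso_tr : \tr iso = 1.
Proof. by rewrite mxtrace_scalar -[LHS]mulr_natr mulVf // gt_eqF. Qed.

Lemma quadp_iso x : quadp iso x = dot x x / (2 * n%:R).
Proof.
rewrite quadpE /qgrad /iso mul_mx_scalar dotZr; field; by rewrite gt_eqF.
Qed.

(* Large enough that [quadp A + ciso * quadp iso] is nonnegative. *)
Let ciso : R := 2 * n%:R ^+ 3 * `|A|.

Lemma quadp_le_iso x : `|quadp A x| <= ciso * quadp iso x.
Proof.
apply: le_trans (quadp_bound A x) _.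
have -> : ciso * quadp iso x = n%:R ^+ 2 * `|A| * dot x x.
  by rewrite quadp_iso /ciso; field; rewrite gt_eqF.
rewrite ler_wpM2l ?mulr_ge0 ?sqr_ge0 // -enorm2 lerXn2r ?nnegrE ?enorm_ge0 //.
exact: norm_le_enorm.
Qed.

Lemma ciso_ge0 : 0 <= ciso. Proof. by rewrite /ciso !mulr_ge0 // exprn_ge0. Qed.

Let wl (B : 'M[R]_n) r :=
  wlape (blg r) (fun x => bl r x - quadp B x) (fun x => blg r x - qgrad B x).

(** The negated combination of test functions is - (a + b) u_r plus the combined quadratic, and both
    are nonnegative on {grad u_r = 0} because u_r <= 0 there. *)
Lemma wl_comb_le0 r (a b : R) : 0 < r <= rmax -> 0 <= a + b ->
  (forall x, 0 <= a * quadp A x + b * quadp iso x) ->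
  a * wl A r + b * wl iso r <= 0.
Proof.
move=> hr ab0 hq; have hs := sol_resc hr; have hv := sol_C11 hs.
have bg := C11_bddv hv.
have hA := C11B hv (C11_quadp sA (ler0n R 3)).
have hI := C11B hv (C11_quadp iso_sym (ler0n R 3)).
rewrite -oppr_ge0 opprD -!mulNr -(wlapeZ _ bg hA) -(wlapeZ _ bg hI).
rewrite -(wlapeD bg (C11Z _ hA) (C11Z _ hI)).
apply: (sol_wlape_ge0 hs); first exact: (C11D (C11Z _ hA) (C11Z _ hI)).
move=> x hx gx; have := sol_npos hs hx gx; rewrite -/(bl r) => v0; have := hq x.
have : 0 <= (a + b) * - bl r x by rewrite mulr_ge0 // oppr_ge0.
lra.
Qed.

Lemma monneau_iso_mono s r : 0 < s -> s <= r -> r <= rmax ->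
  monneau iso (bl s) <= monneau iso (bl r).
Proof.
have [C C0 hC] := monneau_step iso_sym iso_tr blowup_bound_ge0.
apply: (@almost_nondecreasing _ (fun r => monneau iso (bl r)) rmax C C0) => {s}r e hr he hre.
have hr0 := le_rmax hr he hre.
have hE : energy (quadp iso) (qgrad iso) <= energy (bl r) (blg r).
  by rewrite -(energy_quad sA A1 iso_sym iso_tr); exact: energy_ge_quad.
have := hC _ _ _ (sol_resc hr0) he hE.
have [-> _] := dil_sol hr he.
rewrite -/(wl iso r).
have : 0 * wl A r + 1 * wl iso r <= 0.
  apply: wl_comb_le0 => [||x]; [by []|by rewrite add0r ler01|].
  by rewrite mul0r mul1r add0r quadp_iso divr_ge0 ?dot_ge0 // mulr_ge0.
rewrite mul0r add0r mul1r => hw.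
have : 0 <= 2 * e * - wl iso r by rewrite mulr_ge0 ?oppr_ge0 // mulr_ge0 //; case/andP: he => /ltW.
rewrite -/(bl r); lra.
Qed.

(* [quadp A] need not be nonnegative, so [monneau A] alone need not be monotone; the
   multiple of [monneau iso] pays for the sign of [quadp A] on [{grad u = 0}]. *)
Lemma monneau_comb_mono s r : 0 < s -> s <= r -> r <= rmax ->
  monneau A (bl s) + ciso * monneau iso (bl s) <= monneau A (bl r) + ciso * monneau iso (bl r).
Proof.
have [C C0 hC] := monneau_step iso_sym iso_tr blowup_bound_ge0.
have [D D0 hD] := monneau_step sA A1 blowup_bound_ge0.
have CD0 : 0 <= D + ciso * C by rewrite addr_ge0 // mulr_ge0 // ciso_ge0.
apply: (@almost_nondecreasing _ (fun r => monneau A (bl r) + ciso * monneau iso (bl r)) rmax _ CD0)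
  => {s}r e hr he hre.
have hr0 := le_rmax hr he hre.
have hEA := energy_ge_quad hr0.
have hE : energy (quadp iso) (qgrad iso) <= energy (bl r) (blg r).
  by rewrite -(energy_quad sA A1 iso_sym iso_tr).
have h1 := hC _ _ _ (sol_resc hr0) he hE.
have h2 := hD _ _ _ (sol_resc hr0) he hEA.
have [E _] := dil_sol hr he; rewrite -/(bl r) E -/(wl iso r) in h1.
rewrite -/(bl r) E -/(wl A r) in h2.
have hw : 1 * wl A r + ciso * wl iso r <= 0.
  apply: wl_comb_le0 => //; first by have := ciso_ge0; lra.
  by move=> x; have := quadp_le_iso x; rewrite ler_norml mul1r => /andP[]; lra.
have : 0 <= 2 * e * - (1 * wl A r + ciso * wl iso r).
  by rewrite mulr_ge0 ?oppr_ge0 // mulr_ge0 //; case/andP: he => /ltW.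
have := ler_wpM2l ciso_ge0 h1; lra.
Qed.

Lemma monneau_ge0 (B : 'M[R]_n) r : B^T = B -> 0 < r <= rmax -> 0 <= monneau B (bl r).
Proof.
move=> sB hr; have hv := sol_C11 (sol_resc hr).
have bv := C11_bdd3 hv; have bq := C11_bdd3 (C11_quadp sB (ler0n R 3)).
have -> : 0 = 0 * 4 ^+ n :> R by rewrite mul0r.
apply: integ_ge_cst; first by bddt.
by move=> x _; rewrite mulr_ge0 ?sqr_ge0 //; case/andP: (wt_bound x).
Qed.

(** The infimum of the isotropic functional plays the role of its limit at 0. Choose r2 nearly
    attaining it, then s <= r2 where [monneau A] is at most d / 2. For r <= s the combined
    monotonicity bounds [monneau A] at r by d / 2 plus [ciso] times an isotropic drop that the
    choice of r2 keeps small. *)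
Lemma monneau_cvg0 (d : R) : 0 < d ->
  exists2 r1, 0 < r1 <= rmax & forall r, 0 < r <= r1 -> monneau A (bl r) <= d.
Proof.
move=> d0; have c0 := ciso_ge0; have r00 := rmax_gt0.
pose E := [set monneau iso (bl r) | r in [set r | 0 < r <= rmax]].
have infE : has_inf E.
  split; first by exists (monneau iso (bl rmax)); exists rmax => //=; rewrite r00 lexx.
  by exists 0 => _ [r /= hr <-]; exact: monneau_ge0 iso_sym hr.
have d'0 : 0 < d / (2 * (ciso + 1)) by rewrite divr_gt0 // mulr_gt0 //; lra.
have [_ [r2 /= /andP[r20 r2r0] <-] hr2] := inf_adherent d'0 infE.
pose e := Num.min 1 (d / (12 * 4 ^+ n)).
have e0 : 0 < e by rewrite lt_min ltr01 divr_gt0 // mulr_gt0.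
have e1 : e <= 1 by rewrite ge_min lexx.
have [s /andP[s0 sr2] hs] := subseq_cvg e0 r20.
have hsr : 0 < s <= rmax by rewrite s0 (le_trans sr2).
have hM : monneau A (bl s) <= d / 2.
  have : e <= d / (12 * 4 ^+ n) by rewrite ge_min lexx orbT.
  rewrite ler_pdivlMr ?mulr_gt0 // => he.
  apply: (@le_trans _ _ (6 * e * 4 ^+ n)); last by lra.
  apply: le_trans (ler_norm _) _; apply: norm_integ_le => x hx.
  have /andP[w0 w6] := wt_bound x.
  rewrite normrM (ger0_norm w0) ler_pM // normrX.
  apply: (@le_trans _ _ (e ^+ 2)); first by rewrite lerXn2r ?nnegrE ?(ltW e0) ?hs.
  by rewrite expr2 -[leRHS]mul1r ler_wpM2r // ltW.
exists s => // r /andP[r_gt0 rs].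
have hrr : 0 < r <= rmax by rewrite r_gt0 (le_trans rs) //; case/andP: hsr.
have m1 := monneau_comb_mono r_gt0 rs (andP hsr).2.
have m2 := monneau_iso_mono s0 sr2 r2r0.
have m3 : inf E <= monneau iso (bl r) by apply: (inf_lbound infE.2); exists r.
have m4 : ciso * (monneau iso (bl s) - monneau iso (bl r)) <= d / 2.
  apply: (@le_trans _ _ (ciso * (d / (2 * (ciso + 1))))).
    by rewrite ler_wpM2l //; lra.
  by rewrite mulrA ler_pdivrMr ?mulr_gt0 //; nra.
lra.
Qed.

(** Chosen so that n (2 rho)^2 <= 1/4, which keeps the weight away from 0 on the cube of half side 2
    rho. *)
Let rho : R := (4 * (n%:R + 1))^-1.

Lemma rho_gt0 : 0 < rho.
Proof. by rewrite invr_gt0 mulr_gt0 // ltr_wpDl. Qed.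

Lemma wt_lower x : `|x| <= 2 * rho -> 3 <= wt x.
Proof.
move=> hx; have n0 : 0 <= n%:R :> R by [].
have n1 : 0 < n%:R + 1 :> R by lra.
have dx : dot x x <= 4^-1.
  apply: le_trans (ler_norm _) _; apply: le_trans (norm_dot _ _) _.
  apply: (@le_trans _ _ (n%:R * ((2 * rho) * (2 * rho)))); first by rewrite ler_wpM2l // ler_pM.
  have -> : n%:R * (2 * rho * (2 * rho)) = n%:R / (4 * (n%:R + 1) ^+ 2).
    by rewrite /rho; field; rewrite gt_eqF.
  rewrite ler_pdivrMr ?mulr_gt0 ?exprn_gt0 // mulrA mulVf ?mul1r //; nra.
have : 3 / 4 <= gap x by rewrite le_max; apply/orP; right; lra.
rewrite /wt => hg.
have : (3 / 4) ^+ 2 <= gap x ^+ 2 by rewrite lerXn2r ?nnegrE //; lra.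
lra.
Qed.

(** If |u_r - q| > d at some point, the Lipschitz bound [L], uniform in r, keeps it at least d / 2
    on a cube of half side [t]. That cube alone contributes [kap] to the Monneau functional, which
    is at most kap / 2 for small r. *)
Lemma sup_cvg0 (d : R) : 0 < d -> exists2 r1, 0 < r1 <= rmax &
  forall r, 0 < r <= r1 -> forall x, `|x| <= rho -> `|bl r x - quadp A x| <= d.
Proof.
move=> d0; have [Kq hq] := C11_quadp sA (ler0n R 6).
have Kq0 : 0 <= Kq by apply: jet_ge0 hq.
have K0 := blowup_bound_ge0; have rho0 := rho_gt0.
pose L := (n%:R * blowup_bound + 2 * 6 * blowup_bound) + (n%:R * Kq + 2 * 6 * Kq).
have L0 : 0 <= L by rewrite !addr_ge0 // !mulr_ge0.
pose t := Num.min rho (d / (2 * (L + 1))).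
have t0 : 0 < t by rewrite lt_min rho0 divr_gt0 // mulr_gt0 //; lra.
have trho : t <= rho by rewrite ge_min lexx.
have tL : L * t <= d / 2.
  have : t <= d / (2 * (L + 1)) by rewrite ge_min lexx orbT.
  rewrite ler_pdivlMr ?mulr_gt0 //; last by lra.
  by move=> h; lra.
pose kap := 3 * (d / 2) ^+ 2 * t ^+ n.
have kap0 : 0 < kap by rewrite mulr_gt0 ?exprn_gt0 // mulr_gt0 // exprn_gt0 // divr_gt0.
have kap20 : 0 < kap / 2 by rewrite divr_gt0.
have [r1 hr1 hM] := monneau_cvg0 kap20.
exists r1 => // r hr x0 hx0.
have hrr : 0 < r <= rmax.
  by case/andP: hr => -> h; rewrite (le_trans h) //; case/andP: hr1.
have hs := sol_resc hrr; have hj := sol_jet hs.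
rewrite leNgt; apply/negP => hd.
have rho1 : rho <= 1.
  by rewrite invf_le1 ?mulr_gt0 //; have : 0 <= n%:R :> R by []; lra.
have bv := C11_bdd3 (sol_C11 hs); have bq := C11_bdd3 (C11_quadp sA (ler0n R 3)).
have := hM r hr; apply/negP; rewrite -ltNge.
apply: (@lt_le_trans _ _ kap); first by lra.
apply: (@integ_lower _ _ _ x0 t) => //.
- exact: le_trans rho1.
- by move=> i; apply: le_trans (coord_le_norm _ _) (le_trans hx0 rho1).
- by bddt.
- by rewrite mulr_ge0 ?sqr_ge0.
- by move=> x _; rewrite mulr_ge0 ?sqr_ge0 //; case/andP: (wt_bound x).
- move=> x hx hxt.
  have nx : `|x - x0| <= t by apply/norm_leP => [|i]; rewrite ?(ltW t0) // !mxE; exact: hxt.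
  have xr : `|x| <= 2 * rho.
    have -> : x = x0 + (x - x0) by rewrite addrCA subrr addr0.
    by apply: le_trans (ler_normD _ _) _; lra.
  rewrite ler_pM // ?sqr_ge0 ?wt_lower //.
  rewrite -[leRHS]real_normK ?num_real // lerXn2r ?nnegrE //; first by lra.
  have hx6 : `|x| <= 6 by lra.
  have hx06 : `|x0| <= 6 by lra.
  have l1 := jet_lip (ler0n _ _) hj hx06 hx6; have l2 := jet_lip (ler0n _ _) hq hx06 hx6.
  have l3 : `|(bl r x0 - quadp A x0) - (bl r x - quadp A x)| <= L * t.
    have -> : (bl r x0 - quadp A x0) - (bl r x - quadp A x) =
       (quadp A x - quadp A x0) - (bl r x - bl r x0) by ring.
    apply: le_trans (ler_normB _ _) _.
    apply: (@le_trans _ _ (L * `|x - x0|)); last by rewrite ler_wpM2l.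
    by rewrite /L [leRHS]mulrDl addrC lerD.
  have := ler_normD (bl r x - quadp A x) (bl r x0 - quadp A x0 - (bl r x - quadp A x)).
  have -> : bl r x - quadp A x + (bl r x0 - quadp A x0 - (bl r x - quadp A x)) =
    bl r x0 - quadp A x0 by ring.
  lra.
Qed.

(** Changing scale carries the small radius to any radius: u_r(x) = s^2 u_{rs}(x / s), and q is
    homogeneous of degree 2. *)
Lemma sup_cvg0_ball (P d : R) : 0 < P -> 0 < d -> exists2 r1, 0 < r1 &
  forall r, 0 < r <= r1 -> forall x, `|x| <= P -> `|bl r x - quadp A x| <= d.
Proof.
move=> P0 d0; have rho0 := rho_gt0; pose s := P / rho.
have s0 : 0 < s by rewrite divr_gt0.
have ds0 : 0 < d / s ^+ 2 by rewrite divr_gt0 // exprn_gt0.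
have [r1 /andP[r10 _] h] := sup_cvg0 ds0.
exists (r1 / s); first by rewrite divr_gt0.
move=> r /andP[r_gt0 hr] x hx.
have hrs : 0 < r * s <= r1 by rewrite mulr_gt0 //= -ler_pdivlMr.
have hy : `|s^-1 *: x| <= rho.
  rewrite normrZ normfV (gtr0_norm s0) mulrC ler_pdivrMr //.
  by apply: le_trans hx _; rewrite /s mulrC divfK // gt_eqF.
have := h _ hrs _ hy; rewrite ler_pdivlMr ?exprn_gt0 //; apply: le_trans.
rewrite -(gtr0_norm (exprn_gt0 2 s0)) -normrM le_eqVlt.
apply/orP; left; apply/eqP; congr (`|_|).
rewrite quadpZ /bl !rescE scalerA mulfK ?gt_eqF //.
by field; rewrite !gt_eqF.
Qed.

(** A difference quotient with fixed step [t] recovers each gradient component up to K t <= d / 2,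
    and closeness of the values within d t / 4 adds at most another d / 2. *)
Lemma grad_cvg0_ball (P d : R) : 0 < P -> 0 < d -> exists2 r1, 0 < r1 &
  forall r, 0 < r <= r1 -> n%:R * (r * (P + 1)) < 1 /\
    forall x, `|x| <= P -> `|blg r x - qgrad A x| <= d.
Proof.
move=> P0 d0; pose K := tlip + n%:R ^+ 2 * `|A|.
have K0 : 0 <= K by rewrite addr_ge0 ?tlip_ge0 // mulr_ge0 ?sqr_ge0.
pose t := Num.min 1 (d / (2 * (K + 1))).
have t0 : 0 < t by rewrite lt_min ltr01 divr_gt0 // mulr_gt0 //; lra.
have t1 : t <= 1 by rewrite ge_min lexx.
have tK : K * t <= d / 2.
  have : t <= d / (2 * (K + 1)) by rewrite ge_min lexx orbT.
  rewrite ler_pdivlMr ?mulr_gt0 //; last by lra.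
  by move=> h; lra.
have e0 : 0 < d * t / 4 by rewrite divr_gt0 // mulr_gt0.
have P1 : 0 < P + 1 by lra.
have [r1 r10 h] := sup_cvg0_ball P1 e0.
have q0 : 0 < n%:R * (P + 1) + 1 :> R by rewrite ltr_wpDl // mulr_ge0 // ltW.
exists (Num.min r1 (n%:R * (P + 1) + 1)^-1); first by rewrite lt_min r10 invr_gt0.
move=> r /andP[r_gt0]; rewrite le_min => /andP[rr1 rq].
have hc : n%:R * (r * (P + 1)) < 1.
  have : r * (n%:R * (P + 1) + 1) <= 1 by rewrite -ler_pdivlMr // div1r.
  by lra.
split=> // x hx; apply/norm_leP => [|i]; first exact: ltW.
have hx1 : `|x| <= P + 1 by lra.
have hy1 : `|x + t *: evec R i| <= P + 1.
  apply: le_trans (ler_normD _ _) _; rewrite lerD // normrZ (gtr0_norm t0).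
  by rewrite mulr_ile1 ?(ltW t0) // norm_evec.
have T1 := taylor_resc r_gt0 hc hx1 hy1; have T2 := quadp_taylor x (x + t *: evec R i) sA.
have xE : x + t *: evec R i - x = t *: evec R i by rewrite addrC addKr.
rewrite xE !dotZr !dot_evec in T1 T2.
have ht : `|t *: evec R i| ^+ 2 <= t ^+ 2.
  rewrite lerXn2r ?nnegrE ?(ltW t0) // normrZ (gtr0_norm t0) -[leRHS]mulr1.
  by rewrite ler_wpM2l ?(ltW t0) // norm_evec.
have hr : 0 < r <= r1 by rewrite r_gt0.
have S1 := h _ hr _ hx1; have S2 := h _ hr _ hy1.
rewrite -/(bl r) in T1.
have T1' := le_trans T1 (ler_wpM2l tlip_ge0 ht).
have T2' := le_trans T2 (ler_wpM2l (mulr_ge0 (sqr_ge0 n%:R) (normr_ge0 A)) ht).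
set y := x + _ in S2 T1' T2'.
have main : `|t * (blg r x - qgrad A x) 0 i| <= 2 * (d * t / 4) + K * t ^+ 2.
  have -> : t * (blg r x - qgrad A x) 0 i =
    (bl r y - quadp A y) - (bl r x - quadp A x)
    - ((bl r y - bl r x - t * blg r x 0 i) - (quadp A y - quadp A x - t * qgrad A x 0 i)).
    by rewrite !mxE; ring.
  apply: le_trans (ler_normB _ _) _.
  have := ler_normB (bl r y - quadp A y) (bl r x - quadp A x).
  have := ler_normB (bl r y - bl r x - t * blg r x 0 i) (quadp A y - quadp A x - t * qgrad A x 0 i).
  by rewrite /K; lra.
rewrite -(ler_pM2l t0) -{1}(gtr0_norm t0) -normrM; apply: le_trans main _.
have : K * t * t <= d / 2 * t by rewrite ler_wpM2r // ltW.
by lra.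
Qed.

End Limit.

End Blowup.

(** * Hölder interpolation and conclusion *)

Lemma holder_interpolation (R : realType) (L alpha eps : R) :
  0 <= L -> 0 < alpha < 1 -> 0 < eps ->
  exists2 tau, 0 < tau & forall D X, 0 <= D -> X <= L * D -> X <= 2 * tau ->
    X <= eps * D `^ alpha.
Proof.
move=> L0 /andP[a0 a1] e0.
have b0 : 0 < 1 - alpha by rewrite subr_gt0.
have c0 : 0 < eps / (L + 1) by rewrite divr_gt0 //; lra.
(* Threshold distance. For D <= s write L D = L D^(1 - alpha) D^alpha, where D^(1 - alpha) <= eps /
   (L + 1); for D > s the uniform bound 2 tau = eps s^alpha suffices. *)
pose s := (eps / (L + 1)) `^ (1 - alpha)^-1.
have s0 : 0 < s by exact: powR_gt0.
have sE : s `^ (1 - alpha) = eps / (L + 1).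
  by rewrite -powRrM mulVf ?gt_eqF // powRr1 // ltW.
exists (eps * s `^ alpha / 2); first by rewrite divr_gt0 // mulr_gt0 // powR_gt0.
move=> D X D0 h1 h2; have [Ds|sD] := leP D s.
  apply: le_trans h1 _.
  have DE : D = D `^ (1 - alpha) * D `^ alpha.
    by rewrite -powRD subrK ?powRr1 // oner_eq0.
  rewrite {1}DE mulrA ler_wpM2r ?powR_ge0 //.
  apply: (@le_trans _ _ (L * (eps / (L + 1)))).
    by rewrite ler_wpM2l // -sE; apply: ge0_ler_powR; rewrite ?nnegrE // ltW.
  by rewrite mulrA ler_pdivrMr; nra.
apply: le_trans h2 _.
have -> : 2 * (eps * s `^ alpha / 2) = eps * s `^ alpha by field.
by rewrite ler_wpM2l ?(ltW e0) //; apply: ge0_ler_powR; rewrite ?nnegrE // ltW.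
Qed.

(** A nonzero gradient at 0 would stay nonzero nearby by Lipschitz continuity, making 0 an interior
    point of [posgrad u]. *)
Lemma grad_free_boundary (R : realType) (n : nat) (u : 'rV[R]_n -> R) (M : R) : 0 < M ->
  (forall x y, B1 x -> B1 y -> enorm (grad u x - grad u y) <= M * enorm (x - y)) ->
  free_boundary u 0 -> grad u 0 = 0.
Proof.
move=> M0 gM [_ [_ ni]]; apply: contrapT => /eqP g0; apply: ni.
have n1 : 0 < n%:R + 1 :> R by rewrite ltr_wpDl.
have G0 : 0 < `|grad u 0| by rewrite normr_gt0.
have L0 := glip_ge0 n M0.
pose d := Num.min (n%:R + 1)^-1 (`|grad u 0| / (glip n M + 1)).
have d0 : 0 < d by rewrite lt_min invr_gt0 n1 divr_gt0 //; lra.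
have B0 : B1 (0 : 'rV[R]_n) by apply: B1_cube; rewrite normr0 mulr0.
have : \forall x \near nbhs (0 : 'rV[R]_n), `|0 - x| < d.
  by apply: cvgr_dist_lt d0; exact: cvg_id.
rewrite /interior /=; apply: filterS => x; rewrite sub0r normrN lt_min => /andP[h1 h2].
have Bx : B1 x.
  apply: B1_cube.
  by have := normr_ge0 x; move: h1; rewrite -div1r ltr_pdivlMr //; lra.
split=> //; apply/eqP => gx.
have := grad_lip M0 gM B0 Bx; rewrite gx subr0 sub0r normrN.
apply/negP; rewrite -ltNge.
move: h2; rewrite ltr_pdivlMr; last by lra.
by have := normr_ge0 x; nra.
Qed.

Theorem theorem1p1 (R : realType) (n : nat) (u : 'rV[R]_n -> R) :
  supercond_solution u ->
  free_boundary u 0 ->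
  singular_set u 0 ->
  (forall x, B1 x -> grad u x = 0 -> u x <= u 0) ->
  exists q0 : 'rV[R]_n -> R,
    inQ q0 /\
    (forall alpha : R, 0 < alpha < 1 ->
       C1a_loc_cvg (0 : R)^'+ alpha (fun r => resc u 0 r) q0) /\
    (forall eps : R, 0 < eps -> exists delta : R, 0 < delta /\
       forall x, enorm x < delta ->
         `|u x - u 0 - q0 x| <= eps * enorm x ^+ 2).
Proof.
move=> [du [[M [M0 gM]] ae]] fb [_ [rj [q [beta [rj0 [rj_cvg [[A [sA [A1 qE]]] [_ qcvg]]]]]]]] npos.
have grad0 := grad_free_boundary M0 gM fb.
have subseq_cvg (d r1 : R) : 0 < d -> 0 < r1 -> exists2 s : R, 0 < s <= r1 &
    forall x, `|x| <= 2 -> `|resc u 0 s x - quadp A x| <= d.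
  (* The blow-up converges on Euclidean balls, while closeness is wanted on the sup-norm cube of
     half side 2; radius 2 n + 1 covers it. *)
  move=> d0 r10; have rho0 : 0 < n%:R * 2 + 1 :> R by rewrite ltr_wpDl // mulr_ge0.
  have [N1 _ h1] := qcvg _ _ rho0 d0.
  have [N2 _ h2] : \forall j \near \oo, rj j <= r1.
    have := cvgr_le 0 rj_cvg; apply => //.
  exists (rj (maxn N1 N2)).
    by rewrite rj0 /=; apply: h2 => /=; exact: leq_maxr.
  move=> x hx; have [_ hC] := h1 (maxn N1 N2) (leq_maxl _ _).
  have hx' : ecball (n%:R * 2 + 1) x.
    apply: le_trans (enorm_le_norm x) _.
    by apply: (@le_trans _ _ (n%:R * 2)); rewrite ?ler_wpM2l // lerDl.
  by have [] := hC x x hx' hx'; rewrite qE.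
have supc := sup_cvg0_ball M0 du gM ae grad0 npos sA A1 subseq_cvg.
have gradc := grad_cvg0_ball M0 du gM ae grad0 npos sA A1 subseq_cvg.
exists (quadp A); split; first by exists A.
split=> [alpha ha rho eps rho0 eps0|eps eps0].
  have Lg := glip_ge0 n M0; have n0 : 0 <= n%:R :> R by [].
  (* Euclidean Lipschitz constant of grad u_r - grad q, independent of r. Together with the uniform
     smallness of this difference it yields the Hölder seminorm bound by interpolation. *)
  pose L := n%:R * (glip n M + n%:R * `|A|).
  have L0 : 0 <= L by rewrite mulr_ge0 // addr_ge0 // mulr_ge0.
  have [tau tau0 hold] := holder_interpolation L0 ha eps0.
  pose d := Num.min eps tau / (n%:R + 1).
  have m0 : 0 < Num.min eps tau by rewrite lt_min eps0.
  have n1 : 0 < n%:R + 1 :> R by lra.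
  have d0 : 0 < d by rewrite divr_gt0.
  have nd : n%:R * d <= Num.min eps tau by rewrite mulrA ler_pdivrMr; nra.
  have [r1 r10 h1] := supc _ _ rho0 eps0.
  have [r2 r20 h2] := gradc _ _ rho0 d0.
  have rm : 0 < Num.min r1 r2 by rewrite lt_min r10.
  near=> r.
  have r_gt0 : 0 < r by near: r; exact: nbhs_right_gt.
  have : r < Num.min r1 r2 by near: r; exact: nbhs_right_lt.
  rewrite lt_min => /andP[/ltW rr1 /ltW rr2].
  have hr1 : 0 < r <= r1 by rewrite r_gt0.
  have hr2 : 0 < r <= r2 by rewrite r_gt0.
  have [hc hg] := h2 _ hr2.
  have inP x : ecball rho x -> `|x| <= rho by exact: le_trans (norm_le_enorm x).
  have gE x : `|x| <= rho -> grad (resc u 0 r) x = blg u r x.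
    move=> hx; apply: (grad_resc M0 du gM) => //; apply: le_lt_trans hc.
    by rewrite ler_wpM2l // ler_wpM2l ?(ltW r_gt0) // lerD2r.
  have hc' : n%:R * (r * rho) < 1.
    by apply: le_lt_trans hc; rewrite ler_wpM2l // ler_wpM2l ?(ltW r_gt0) // lerDl.
  split=> [x /inP hx|x y /inP hx /inP hy].
    apply: (differentiable_resc du); apply: B1_cube; apply: le_lt_trans hc'.
    by rewrite ler_wpM2l // normrZ (gtr0_norm r_gt0) ler_wpM2l // ltW.
  rewrite !gE // !grad_quadp //; split; [exact: h1|split].
    apply: le_trans (enorm_le_norm _) _.
    apply: (@le_trans _ _ (n%:R * d)); first by rewrite ler_wpM2l // hg.
    by apply: le_trans nd _; rewrite ge_min lexx.
  apply: hold; first exact: enorm_ge0.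
    apply: le_trans (enorm_le_norm _) _; rewrite /L -mulrA ler_wpM2l //.
    apply: (@le_trans _ _ ((glip n M + n%:R * `|A|) * `|x - y|)); last first.
      by rewrite ler_wpM2l ?norm_le_enorm // addr_ge0 // mulr_ge0.
    have -> : blg u r x - qgrad A x - (blg u r y - qgrad A y) =
        (blg u r x - blg u r y) - qgrad A (x - y).
      by rewrite /qgrad mulmxBl !opprB addrACA [RHS]addrACA [- _ - _ in RHS]addrC.
    apply: le_trans (ler_normB _ _) _; rewrite mulrDl lerD //.
      exact: (blg_lip M0 gM r_gt0 hc' hx hy).
    by apply: le_trans (norm_mulmx _ _) _; rewrite -mulrA [`|A| * _]mulrC.
  apply: le_trans (enorm_le_norm _) _.
  apply: (@le_trans _ _ (n%:R * (d + d))).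
    rewrite ler_wpM2l //; apply: le_trans (ler_normB _ _) _.
    by rewrite lerD // hg.
  have : Num.min eps tau <= tau by rewrite ge_min lexx orbT.
  by move: nd; lra.
have [r1 r10 h1] := supc _ _ ltr01 eps0.
exists r1; split=> // x hx.
have [->|x0] := eqVneq x 0.
  rewrite subrr sub0r normrN -(scale0r (0 : 'rV[R]_n)) quadpZ expr0n mul0r normr0.
  by rewrite mulr_ge0 ?sqr_ge0 // ltW.
(* With r the sup norm of x, write x = r y with y of norm 1: closeness of u_r to q at y, multiplied
   by r^2, is the expansion at x. *)
have r_gt0 : 0 < `|x| by rewrite normr_gt0.
have hr : 0 < `|x| <= r1 by rewrite r_gt0 (le_trans (norm_le_enorm x)) // ltW.
have hy : `| `|x|^-1 *: x| <= 1 by rewrite normrZ normfV normr_id mulVf // gt_eqF.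
have := h1 _ hr _ hy; rewrite rescE quadpZ scalerA mulfV ?gt_eqF // scale1r.
have -> : (u x - u 0) / `|x| ^+ 2 - `|x|^-1 ^+ 2 * quadp A x =
    (u x - u 0 - quadp A x) / `|x| ^+ 2 by rewrite exprVn; field; rewrite gt_eqF.
rewrite normrM normfV [`| `|x| ^+ 2|]ger0_norm ?sqr_ge0 // ler_pdivrMr ?exprn_gt0 //.
move=> /le_trans; apply; rewrite ler_wpM2l ?(ltW eps0) // lerXn2r ?nnegrE ?enorm_ge0 //.
exact: norm_le_enorm.
Unshelve. all: end_near. Qed.
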